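(* Fix $d$ and a constant $c_0\in(0,1)$. There exist constants $C,c>0$ such that the following holds. Consider the synchronous (generative) observation model with $n$ samples for a $(d-1)$st order state aggregatable Markov process on $\{1,\dots,p\}$ with parameters $(r_1,\dots,r_{d-1})$ and transition tensor $\boldsymbol{\mathcal P}$, and let $\widehat{\boldsymbol{\mathcal P}}^{\mathrm{emp}}$ be the empirical transition tensor. Run TTOI on $\boldsymbol{\mathcal Y}=\widehat{\boldsymbol{\mathcal P}}^{\mathrm{emp}}$ with $p_1=\cdots=p_d=p$ and input ranks $(r_1,\dots,r_{d-1})$. Suppose the initialization condition $$\bigl\|\sin\Theta(\widehat U_k^{(0)},\widetilde U_k^{(0)})\bigr\|\le c_0,\qquad1\le k\le d-1,$$ holds, where $\widetilde U_1^{(0)}\in\mathbb{R}^{p\times r_1}$ is the left singular space of $[\boldsymbol{\mathcal P}]_1$ and, for $2\le k\le d-1$, $\widetilde U_k^{(0)}\in\mathbb{R}^{(pr_{k-1})\times r_k}$ is the left singular space of $\bigl(I_p\otimes(\widehat U^{(0)})_{\mathrm{prod},k-1}^{(L)\top}\bigr)[\boldsymbol{\mathcal P}]_k$. Let $\widehat{\boldsymbol{\mathcal P}}$ be the output of one-step TTOI followed by the probability simplex projection. Then with probability at least $1-Ce^{-cp}$, $$\bigl\|\widehat{\boldsymbol{\mathcal P}}-\boldsymbol{\mathcal P}\bigr\|_{\mathrm F}^2\le C\Bigl(\max_{1\le i\le d-1}r_i\Bigr)\frac{\sum_{i=1}^dp_ir_ir_{i-1}}{n}.$$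
   Context: Throughout $d\ge2$, $p$ and $r_1,\dots,r_{d-1}$ are positive integers, $p_1=\cdots=p_d=p$, $r_0=r_d=1$. Markov model. Consider an ergodic, time-invariant, $(d-1)$st order Markov process on $[p]=\{1,\dots,p\}$ with transition tensor $\boldsymbol{\mathcal P}\in\mathbb{R}^{p\times\cdots\times p}$ (order $d$): $\mathbb{P}(X_{t+d}\mid X_1,\dots,X_{t+d-1})=\mathbb{P}(X_{t+d}\mid X_{t+1},\dots,X_{t+d-1})=\boldsymbol{\mathcal P}_{[X_{t+1},\dots,X_{t+d}]}$. It is $(d-1)$st order state aggregatable (with parameters $r_1,\dots,r_{d-1}$) if there exist maps $G_1:[p]\to\mathbb{R}^{r_1}$, $G_k:[p]\times\mathbb{R}^{r_{k-1}}\to\mathbb{R}^{r_k}$ ($2\le k\le d-1$), $G_d:[p]\times\mathbb{R}^{r_{d-1}}\to\mathbb{R}$, with $G_2,\dots,G_d$ linear in the second argument, such that, with $\widetilde P_1(i_1)=G_1(i_1)$ and $\widetilde P_k(i_1,\dots,i_k)=G_k(i_k,\widetilde P_{k-1}(i_1,\dots,i_{k-1}))$ for $2\le k\le d-1$, one has $\boldsymbol{\mathcal P}_{i_1,\dots,i_d}=G_d(i_d,\widetilde P_{d-1}(i_1,\dots,i_{d-1}))$ for all $i_1,\dots,i_d\in[p]$. Synchronous (generative) model: for each sample index $k=1,\dots,n$ and each $(i_1,\dots,i_{d-1})\in[p]^{d-1}$, one observes a next state $X(i_1,\dots,i_{d-1};k)\in[p]$ drawn with $\mathbb{P}(X(i_1,\dots,i_{d-1};k)=i_d)=\boldsymbol{\mathcal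 P}_{i_1,\dots,i_d}$, all these draws being independent. The empirical transition tensor is $\widehat{\boldsymbol{\mathcal P}}^{\mathrm{emp}}_{i_1,\dots,i_d}=\frac1n\sum_{k=1}^n1_{\{X(i_1,\dots,i_{d-1};k)=i_d\}}$. Estimator. TTOI (below) is run on $\boldsymbol{\mathcal Y}=\widehat{\boldsymbol{\mathcal P}}^{\mathrm{emp}}$ and stopped after one iteration (initialization plus the backward update $t=1$), giving $\widehat{\boldsymbol{\mathcal P}}^{(1)}:=\widehat{\boldsymbol{\mathcal X}}^{(1)}$. Then each row of $[\widehat{\boldsymbol{\mathcal P}}^{(1)}]_{d-1}$, i.e. each mode-$d$ fiber of $\widehat{\boldsymbol{\mathcal P}}^{(1)}$, is replaced by its Euclidean projection onto the simplex $\{x\in\mathbb{R}^p:\sum_ix_i=1,\ x_i\ge0\}$; the resulting tensor is $\widehat{\boldsymbol{\mathcal P}}$. Matrices and tensors. $s_j(A)$ is the $j$th largest singular value of $A$; $\|\cdot\|_{\mathrm F}$ is the entrywise Frobenius norm. $\mathrm{SVD}^L_r(A)$ and $\mathrm{SVD}^R_r(A)$ are the matrices with orthonormal columns consisting of the leading $r$ left, respectively right, singular vectors of $A$ (any choice in case of ties). The ''left singular space'' of a matrix, given with $r$ columns, is the matrix of its leading $r$ left singular vectors. $U\otimes V$ is the usual Kronecker product, with blocks $U_{ij}V$. For $U,\widehat U\in\mathbb{R}^{m\times r}$ with orthonormal columns, $\|\sin\Theta(U,\widehat U)\|=\sqrt{1-s_r(U^\top\widehat U)^2}$. The sequential unfolding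 $[\boldsymbol{\mathcal X}]_k\in\mathbb{R}^{(p_1\cdots p_k)\times(p_{k+1}\cdots p_d)}$ has entry $\boldsymbol{\mathcal X}_{i_1,\dots,i_d}$ at row $i_1+(i_2-1)p_1+\cdots+(i_k-1)p_1\cdots p_{k-1}$ and column $i_{k+1}+(i_{k+2}-1)p_{k+1}+\cdots+(i_d-1)p_{k+1}\cdots p_{d-1}$. $\mathrm{Reshape}$ of matrices is column-major: for $A\in\mathbb{R}^{q_1\times q_2q_3}$ and $\widetilde A\in\mathbb{R}^{q_1q_2\times q_3}$, $\widetilde A=\mathrm{Reshape}(A,q_1q_2,q_3)$ iff $\widetilde A_{(i_2-1)q_1+i_1,i_3}=A_{i_1,(i_3-1)q_2+i_2}$ for all indices. It is understood that $r_k\le r_{k-1}p_k$ and $r_{k-1}\le p_kr_k$ for all $k$, so that all matrices of singular vectors exist. Sequential products. For $M_i\in\mathbb{R}^{(p_ir_{i-1})\times r_i}$ ($1\le i\le d-1$): $M_{\mathrm{prod},1}^{(L)}=M_1$, $M_{\mathrm{prod},k+1}^{(L)}=(I_{p_{k+1}}\otimes M_{\mathrm{prod},k}^{(L)})M_{k+1}$. For $B_j\in\mathbb{R}^{(p_jr_j)\times r_{j-1}}$ ($2\le j\le d$): $B_{\mathrm{prod},d}^{(R)}=B_d$, $B_{\mathrm{prod},k}^{(R)}=(B_{\mathrm{prod},k+1}^{(R)}\otimes I_{p_k})B_k$. One-step TTOI with input $\boldsymbol{\mathcal Y}$ and ranks $r_1,\dots,r_{d-1}$. Initialization: $R_1^{(0)}=[\boldsymbol{\mathcal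 Y}]_1$; for $k=1,\dots,d-1$, $\widehat U_k^{(0)}=\mathrm{SVD}^L_{r_k}(R_k^{(0)})$, $\widetilde R_k^{(0)}=\widehat U_k^{(0)\top}R_k^{(0)}$, and if $k<d-1$, $R_{k+1}^{(0)}=\mathrm{Reshape}(\widetilde R_k^{(0)},r_kp_{k+1},p_{k+2}\cdots p_d)$. Backward update: $\widehat V_d^{(1)}=\mathrm{SVD}^R_{r_{d-1}}(\widetilde R_{d-1}^{(0)})$; for $k=d-1,\dots,2$, $\widehat V_k^{(1)}=\mathrm{SVD}^R_{r_{k-1}}\bigl(\widetilde R_{k-1}^{(0)}((\widehat V^{(1)})_{\mathrm{prod},k+1}^{(R)}\otimes I_{p_k})\bigr)$; then $[\widehat{\boldsymbol{\mathcal X}}^{(1)}]_1=[\boldsymbol{\mathcal Y}]_1(\widehat V^{(1)})_{\mathrm{prod},2}^{(R)}(\widehat V^{(1)})_{\mathrm{prod},2}^{(R)\top}$. *)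

(* Defs.v *)
From HB Require Import structures.
From mathcomp Require Import all_boot all_order all_algebra.
From mathcomp Require Import mxtens.
From mathcomp Require Import all_classical all_reals all_analysis.

Set Implicit Arguments.
Unset Strict Implicit.
Unset Printing Implicit Defensive.

Import Order.TTheory GRing.Theory Num.Theory.
Local Open Scope classical_set_scope.
Local Open Scope ring_scope.

(* Kronecker products are those of [mxtens]: row [i * p + j] of [A *t B] pairs
   row [i] of [A] with row [j] of [B : 'M_(p, q)]. Tensor modes and state
   indices are 0-based; the matrix families [U], [V], the ranks [r] and the
   unfoldings are numbered from 1 as in the mathematical text. *)

Section Matrices.
Variable R : realType.

(* [A] itself whenever the two shapes agree, which is provable but not
   definitional wherever this is used. *)
Definition recast m n m' n' (A : 'M[R]_(m, n)) : 'M[R]_(m', n') :=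
  conform_mx (0 : 'M[R]_(m', n')) A.

(* Column-major: the sum has exactly one term when m * n = m' * n'. *)
Definition reshape m n m' n' (A : 'M[R]_(m, n)) : 'M[R]_(m', n') :=
  \matrix_(i < m', j < n')
    \sum_(a < m) \sum_(b < n | (a + b * m == i + j * m')%N) A a b.

Definition is_svd m n (A : 'M[R]_(m, n))
    (L : 'M[R]_m) (S : 'M[R]_(m, n)) (Q : 'M[R]_n) : Prop :=
  [/\ L^T *m L = 1%:M, Q^T *m Q = 1%:M, A = L *m S *m Q^T,
      (forall (i : 'I_m) (j : 'I_n), i != j :> nat -> S i j = 0) &
      (forall (i : 'I_m) (j : 'I_n), i = j :> nat -> 0 <= S i j) /\
      (forall (i i' : 'I_m) (j j' : 'I_n), i = j :> nat -> i' = j' :> nat ->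
         (i <= i')%N -> S i' j' <= S i j)].

(* The [j]th largest singular value of [A], with [j] counted from 1. *)
Definition singular_value m n (A : 'M[R]_(m, n)) (j : nat) : R :=
  xget 0 [set s | exists L S Q, is_svd A L S Q /\
    exists (a : 'I_m) (b : 'I_n), [/\ a.+1 = j, b.+1 = j & s = S a b]].

Definition is_svdL m n q (A : 'M[R]_(m, n)) (U : 'M[R]_(m, q)) : Prop :=
  exists (le_qm : (q <= m)%N) L S Q,
    is_svd A L S Q /\ U = colsub (widen_ord le_qm) L.

Definition is_svdR m n q (A : 'M[R]_(m, n)) (V : 'M[R]_(n, q)) : Prop :=
  exists (le_qn : (q <= n)%N) L S Q,
    is_svd A L S Q /\ V = colsub (widen_ord le_qn) Q.

Definition sinTheta m q (U Uh : 'M[R]_(m, q)) : R :=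
  Num.sqrt (1 - singular_value (U^T *m Uh) q ^+ 2).

End Matrices.

Definition midx (p d : nat) := {ffun 'I_d -> 'I_p}.
Definition tensor (R : realType) (p d : nat) := midx p d -> R.

Section Indices.
Variables (p d : nat).

Lemma next_subproof (t : 'I_d.-1) : (t.+1 < d)%N.
Proof. by rewrite -ltn_predRL. Qed.

Definition front (i : midx p d) : midx p d.-1 :=
  [ffun t => i (widen_ord (leq_pred d) t)].
Definition back (i : midx p d) : midx p d.-1 :=
  [ffun t => i (Ordinal (next_subproof t))].

(* (i_1, ..., i_{d-1}), x |-> (i_1, ..., i_{d-1}, x) *)
Definition snoc (c : midx p d.-1) (x : 'I_p) : midx p d :=
  [ffun t : 'I_d => if insub (t : nat) is Some t' then c t' else x].

End Indices.

Section Tensors.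
Variables (R : realType) (p d : nat).

(* When 1 <= k <= d each entry is a sum with exactly one term. *)
Definition unfold (k : nat) (X : tensor R p d) : 'M[R]_(p ^ k, p ^ (d - k)) :=
  \matrix_(a, b)
    \sum_(i : midx p d
          | (\sum_(t < d | (t < k)%N) i t * p ^ t == a)%N &&
            (\sum_(t < d | (k <= t)%N) i t * p ^ (t - k) == b)%N) X i.

Definition fnorm2_dist (X Y : tensor R p d) : R :=
  \sum_(i : midx p d) (X i - Y i) ^+ 2.

End Tensors.

Section Markov.
Variables (R : realType) (p d : nat).

Definition transition_tensor (P : tensor R p d) : Prop :=
  (forall i, 0 <= P i) /\
  (forall c : midx p d.-1, \sum_(x < p) P (snoc c x) = 1).

(* [m]-step transition probabilities of the first-order chain
   (X_{t+1}, ..., X_{t+d-1}) on [p]^(d-1). *)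
Definition lifted (P : tensor R p d) (c c' : midx p d.-1) : R :=
  \sum_(i : midx p d | (front i == c) && (back i == c')) P i.

Fixpoint lifted_iter (P : tensor R p d) (m : nat) (c c' : midx p d.-1) : R :=
  if m is m'.+1 then \sum_e lifted P c e * lifted_iter P m' e c'
  else (c == c')%:R.

Definition irreducible_chain (P : tensor R p d) : Prop :=
  forall c c', exists m, 0 < lifted_iter P m c c'.

Definition aperiodic_chain (P : tensor R p d) : Prop :=
  forall c g, (forall m, (0 < m)%N -> 0 < lifted_iter P m c c -> (g %| m)%N) ->
    g = 1%N.

Definition ergodic (P : tensor R p d) : Prop :=
  irreducible_chain P /\ aperiodic_chain P.

(* [aggregate r G1 G i k] is Ptilde_k(i_1, ..., i_k), where the state i_{t+1}
   is [i t] and [G k] is the map G_{k+1}; the value at k = 0 is a dummy. *)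
Fixpoint aggregate (r : nat -> nat) (G1 : 'I_p -> 'cV[R]_(r 1%N))
    (G : forall k, 'I_p -> 'cV[R]_(r k) -> 'cV[R]_(r k.+1))
    (i : nat -> 'I_p) (k : nat) : 'cV[R]_(r k) :=
  match k return 'cV[R]_(r k) with
  | 0 => 0
  | k'.+1 =>
      match k' return 'cV[R]_(r k') -> 'cV[R]_(r k'.+1) with
      | 0 => fun=> G1 (i 0%N)
      | k''.+1 => G k''.+1 (i k''.+1)
      end (aggregate G1 G i k')
  end.

Definition state_aggregatable (r : nat -> nat) (P : tensor R p d) : Prop :=
  exists (G1 : 'I_p -> 'cV[R]_(r 1%N))
         (G : forall k, 'I_p -> 'cV[R]_(r k) -> 'cV[R]_(r k.+1))
         (Gd : 'I_p -> 'cV[R]_(r d.-1) -> R),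
    [/\ (forall k x, (1 <= k < d.-1)%N -> linear (G k x)),
        (forall x, scalar (Gd x)) &
        forall i : nat -> 'I_p,
          P [ffun t : 'I_d => i t] = Gd (i d.-1) (aggregate G1 G i d.-1)].

End Markov.

Section TTOI.
Variables (R : realType) (p d : nat) (r : nat -> nat).

(* Rows of a left factor M_k form p blocks of length r_{k-1}, those of a right
   factor B_k form r_k blocks of length p, as the Kronecker products
   I_p (x) M_prod and B_prod (x) I_p require. *)
Definition left_family := forall k, 'M[R]_(p * r k.-1, r k).
Definition right_family := forall k, 'M[R]_(r k * p, r k.-1).

(* M_{prod,k}^(L); the value at k = 0 is a dummy. *)
Fixpoint prodL (M : left_family) (k : nat) : 'M[R]_(p ^ k, r k) :=
  if k is k'.+1 then
    if k' == 0%N then recast _ _ (M k'.+1)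
    else recast _ _ (((1%:M : 'M[R]_p) *t prodL M k') *m M k'.+1)
  else 0.

(* The product of the factors B_k, ..., B_{k+m}. *)
Fixpoint prodR_rec (B : right_family) (m k : nat) :
    'M[R]_(p ^ m.+1, r k.-1) :=
  if m is m'.+1 then
    recast _ _ ((prodR_rec B m' k.+1 *t (1%:M : 'M[R]_p)) *m B k)
  else recast _ _ (B k).

(* B_{prod,k}^(R) *)
Definition prodR (B : right_family) (k : nat) :
  'M[R]_(p ^ (d - k).+1, r k.-1) := prodR_rec B (d - k) k.

(* R_k^(0); the value at k = 0 is a dummy. *)
Fixpoint resid (Y : tensor R p d) (U : left_family) (k : nat) :
    'M[R]_(p * r k.-1, p ^ (d - k)) :=
  if k is k'.+1 then
    if k' == 0%N then recast _ _ (unfold 1 Y)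
    else reshape _ _ ((U k')^T *m resid Y U k')
  else 0.

(* Rtilde_k^(0) *)
Definition tresid (Y : tensor R p d) (U : left_family) (k : nat) :
  'M[R]_(r k, p ^ (d - k)) := (U k)^T *m resid Y U k.

(* [U k] = Uhat_k^(0) for 1 <= k <= d-1, [V k] = Vhat_k^(1) for 2 <= k <= d and
   [X1] = Xhat^(1) are an outcome of one-step TTOI on [Y], for some choice of
   the singular vectors. *)
Definition one_step_TTOI (Y : tensor R p d)
    (U : left_family) (V : right_family) (X1 : tensor R p d) : Prop :=
  [/\ (forall k, (1 <= k < d)%N -> is_svdL (resid Y U k) (U k)),
      is_svdR (recast (r d.-1) (r d * p) (tresid Y U d.-1)) (V d),
      (forall k, (2 <= k < d)%N ->
         is_svdR (tresid Y U k.-1 *m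
                  recast (p ^ (d - k.-1)) (r k * p)
                    (prodR V k.+1 *t (1%:M : 'M[R]_p))) (V k)) &
      let W : 'M[R]_(p ^ (d - 1), r 1%N) := recast _ _ (prodR V 2) in
      unfold 1 X1 = unfold 1 Y *m W *m W^T].

(* The matrix whose left singular space is Utilde_k^(0). *)
Definition init_target (P : tensor R p d) (U : left_family) (k : nat) :
    'M[R]_(p * r k.-1, p ^ (d - k)) :=
  if k == 1%N then recast _ _ (unfold 1 P)
  else ((1%:M : 'M[R]_p) *t (prodL U k.-1)^T) *m
       recast (p * p ^ k.-1) (p ^ (d - k)) (unfold k P).

Definition init_condition (c0 : R) (P : tensor R p d)
    (U Ut : left_family) : Prop :=
  forall k, (1 <= k < d)%N ->
    is_svdL (init_target P U k) (Ut k) /\ sinTheta (U k) (Ut k) <= c0.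

End TTOI.

Section Simplex.
Variables (R : realType) (p d : nat).

Definition simplex (x : 'I_p -> R) : Prop :=
  \sum_i x i = 1 /\ forall i, 0 <= x i.

Definition is_simplex_proj (x y : 'I_p -> R) : Prop :=
  simplex y /\
  forall z, simplex z ->
    Num.sqrt (\sum_i (x i - y i) ^+ 2) <= Num.sqrt (\sum_i (x i - z i) ^+ 2).

Definition is_fiber_proj (X1 X : tensor R p d) : Prop :=
  forall c : midx p d.-1,
    is_simplex_proj (fun x => X1 (snoc c x)) (fun x => X (snoc c x)).

End Simplex.

Section Sampling.
Variables (R : realType) (p d : nat).
Variables (disp : measure_display) (T : measurableType disp).
Variable (Pr : probability T R).

Definition mutually_independent (I A : finType) (X : I -> T -> A) : Prop :=
  forall (J : {set I}) (B : I -> {set A}),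
    Pr [set w | forall i, i \in J -> X i w \in B i] =
    (\prod_(i in J) Pr [set w | X i w \in B i])%E.

Definition generative_model (P : tensor R p d) (n : nat)
    (X : midx p d.-1 -> 'I_n -> T -> 'I_p) : Prop :=
  [/\ (forall c k x, measurable [set w | X c k w = x]),
      (forall c k x, Pr [set w | X c k w = x] = (P (snoc c x))%:E) &
      mutually_independent
        (fun (ck : midx p d.-1 * 'I_n) => X ck.1 ck.2)].

(* [snoc (front i) x == i] says that the last coordinate of [i] is [x]. *)
Definition empirical (n : nat) (X : midx p d.-1 -> 'I_n -> T -> 'I_p) (w : T) :
    tensor R p d :=
  fun i => n%:R^-1 *
    \sum_(k < n) (snoc (front i) (X (front i) k w) == i)%:R.

End Sampling.

(* Main.v *)
Require Import Defs.
From HB Require Import structures.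
From mathcomp Require Import all_boot all_order all_algebra.
From mathcomp Require Import mxtens ring lra zify.
From mathcomp Require Import all_classical all_reals all_analysis.

(** The transition tensor [P] of an aggregatable process has tensor-train rank
    at most [r]: a state sequence enters the future only through its aggregate,
    a vector on which the rest of the chain acts linearly
    ([aggregatable_rank]). The observed tensor is [P] plus a noise with
    independent centered fibers, so that a test tensor [T] pairs with the noise
    to a sub-Gaussian variable of variance of order [|T|^2 / n]
    ([chernoff_pairing]). The theorem combines two facts.

    The first is deterministic ([one_step_error]): the squared error is at most a
    constant, depending on [d] and [c0], times [e^2], where [e] bounds the pairing
    of the noise with every tensor train of norm 1 with cores of squared norm at
    most [rm], the largest rank. Each right factor [V k] consists of the leading
    right singular vectors of [A + E], where [A] is the signal compressed by the
    left factors before and the right factors after mode [k], and [E] the noise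
    compressed in the same way. By [Eckart_Young], [A] loses at most [2 |E|]
    outside the range of [V k] ([low_rank_residual]). The condition on [sinTheta]
    says that compressing by the left factors shrinks the signal by at most a
    constant factor, so the same loss, up to that factor, is suffered by the
    uncompressed signal ([left_projection_lower_bound]); the losses of the
    successive factors add up ([right_space_residual]). Finally [E] is itself a
    core: put back between the orthonormal factors it becomes a tensor train of
    norm [|E|] which pairs with the noise to [|E|^2], whence [|E| <= e]
    ([compressed_noise]).

    The second is probabilistic ([large_noise_weight]): with probability
    [1 - exp (- rm N)], [e^2] is at most a constant times [rm N / n], where
    [N = sum_i p r_i r_(i-1)] counts the core entries. The pairing of the noise
    with a tensor train is affine in each core entry, so the entries may be moved
    to a grid one at a time without decreasing it ([round_multiaffine]); the mesh
    is so fine that the norm of the train is at most 2. The grid points that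
    occur number at most [(C rm ^ (d + 1)) ^ N], by weighting them with Gaussian
    weights ([grid_ball_card]). As [log rm <= rm], the union bound costs a factor
    [rm] in the exponent, which is the maximal rank in the statement. Everything
    here lives on the finitely many outcomes of the sampling
    ([probability_observed]).

    The projection onto the simplex at most doubles the error
    ([fiber_proj_error]). Since [N >= p], the failure probability is at most
    [exp (- p)]. *)

Set Implicit Arguments.
Unset Strict Implicit.
Unset Printing Implicit Defensive.

Import Order.TTheory GRing.Theory Num.Theory.
Local Open Scope classical_set_scope.
Local Open Scope ring_scope.

(** * Frobenius norms, projectors and singular vectors *)

Section Frobenius.
Variable R : realType.

Definition fnorm2 m n (A : 'M[R]_(m, n)) : R := \sum_i \sum_j A i j ^+ 2.

Lemma fnorm2_ge0 m n (A : 'M[R]_(m, n)) : 0 <= fnorm2 A.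
Proof. by apply: sumr_ge0 => i _; apply: sumr_ge0 => j _; apply: sqr_ge0. Qed.

Lemma fnorm2_trmx m n (A : 'M[R]_(m, n)) : fnorm2 A^T = fnorm2 A.
Proof.
by rewrite /fnorm2 exchange_big; do 2!apply: eq_bigr => ? _; rewrite mxE.
Qed.

Lemma fnorm2_tr m n (A : 'M[R]_(m, n)) : fnorm2 A = \tr (A^T *m A).
Proof.
rewrite /fnorm2 exchange_big; apply: eq_bigr => j _; rewrite !mxE.
by apply: eq_bigr => i _; rewrite mxE expr2.
Qed.

Lemma mxtrace_trmx_mul m n (A B : 'M[R]_(m, n)) :
  \tr (A^T *m B) = \sum_i \sum_j A i j * B i j.
Proof.
rewrite exchange_big; apply: eq_bigr => j _; rewrite mxE.
by apply: eq_bigr => i _; rewrite mxE.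
Qed.

Lemma fnorm2N m n (A : 'M[R]_(m, n)) : fnorm2 (- A) = fnorm2 A.
Proof. by do 2!apply: eq_bigr => ? _; rewrite mxE sqrrN. Qed.

Lemma fnorm2D m n (A B : 'M[R]_(m, n)) :
  fnorm2 (A + B) <= 2 * fnorm2 A + 2 * fnorm2 B.
Proof.
rewrite /fnorm2 !mulr_sumr -big_split /=; apply: ler_sum => i _.
rewrite !mulr_sumr -big_split /=; apply: ler_sum => j _.
rewrite mxE; have := sqr_ge0 (A i j - B i j); nra.
Qed.

Lemma fnorm2B m n (A B : 'M[R]_(m, n)) :
  fnorm2 (A - B) <= 2 * fnorm2 A + 2 * fnorm2 B.
Proof. by have := fnorm2D A (- B); rewrite fnorm2N. Qed.

Lemma fnorm2_eq0 m n (A : 'M[R]_(m, n)) : fnorm2 A = 0 -> A = 0.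
Proof.
move/eqP; rewrite psumr_eq0 => [/allP h|i _]; last first.
  by apply: sumr_ge0 => j _; apply: sqr_ge0.
apply/matrixP => i j; rewrite mxE; apply/eqP.
have := h i (mem_index_enum _); rewrite psumr_eq0 => [/allP h'|? _]; last first.
  exact: sqr_ge0.
by have := h' j (mem_index_enum _); rewrite sqrf_eq0.
Qed.

Lemma fnorm2_isoL m n q (Q : 'M[R]_(m, n)) (A : 'M[R]_(n, q)) :
  Q^T *m Q = 1%:M -> fnorm2 (Q *m A) = fnorm2 A.
Proof.
by move=> hQ; rewrite !fnorm2_tr trmx_mul -mulmxA (mulmxA _ Q) hQ mul1mx.
Qed.

Lemma fnorm2_isoR m n q (Q : 'M[R]_(m, n)) (A : 'M[R]_(q, n)) :
  Q^T *m Q = 1%:M -> fnorm2 (A *m Q^T) = fnorm2 A.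
Proof.
by move=> hQ; rewrite -fnorm2_trmx trmx_mul trmxK fnorm2_isoL // fnorm2_trmx.
Qed.

Definition projector n (Pi : 'M[R]_n) : Prop := Pi^T = Pi /\ Pi *m Pi = Pi.

Lemma projector_gram n q (V : 'M[R]_(n, q)) :
  V^T *m V = 1%:M -> projector (V *m V^T).
Proof.
move=> hV; split; first by rewrite trmx_mul trmxK.
by rewrite mulmxA -(mulmxA V) hV mulmx1.
Qed.

Lemma projectorC n (Pi : 'M[R]_n) : projector Pi -> projector (1%:M - Pi).
Proof.
case=> hT hI; split; first by rewrite linearB /= trmx1 hT.
by rewrite mulmxBr mulmx1 mulmxBl mul1mx hI subrr subr0.
Qed.

Lemma fnorm2_mul_projector m n (A : 'M[R]_(m, n)) (Pi : 'M[R]_n) :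
  projector Pi -> fnorm2 (A *m Pi) = \tr (A^T *m A *m Pi).
Proof.
case=> hT hI; rewrite fnorm2_tr trmx_mul hT mulmxA mxtrace_mulC !mulmxA hI.
by rewrite -mulmxA mxtrace_mulC.
Qed.

Lemma fnorm2_pythagoras m n (A : 'M[R]_(m, n)) (Pi : 'M[R]_n) :
  projector Pi -> fnorm2 (A *m Pi) + fnorm2 (A *m (1%:M - Pi)) = fnorm2 A.
Proof.
move=> hPi; rewrite !fnorm2_mul_projector //; last exact: projectorC.
by rewrite -mxtraceD -mulmxDr addrC subrK mulmx1 fnorm2_tr.
Qed.

Lemma fnorm2_projector_le m n (A : 'M[R]_(m, n)) (Pi : 'M[R]_n) :
  projector Pi -> fnorm2 (A *m Pi) <= fnorm2 A.
Proof. by move/(fnorm2_pythagoras A) <-; rewrite lerDl fnorm2_ge0. Qed.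

Lemma projector_diag n (Pi : 'M[R]_n) i : projector Pi -> 0 <= Pi i i <= 1.
Proof.
case=> hT hI.
have e : Pi i i = \sum_j Pi i j ^+ 2.
  rewrite -{1}hI mxE; apply: eq_bigr => j _.
  by rewrite -{2}hT mxE expr2.
have h0 : 0 <= Pi i i by rewrite e; apply: sumr_ge0 => j _; apply: sqr_ge0.
have h1 : Pi i i ^+ 2 <= Pi i i.
  rewrite {2}e (bigD1 i) //= lerDl; apply: sumr_ge0 => j _; apply: sqr_ge0.
rewrite h0 /=; case: (ltrP 0 (Pi i i)) => h; nra.
Qed.

Lemma gram_unit m n (W : 'M[R]_(m, n)) : row_free W -> W *m W^T \in unitmx.
Proof.
move=> fW; rewrite -row_free_unit -kermx_eq0; apply/eqP/row_matrixP => i.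
set x := row i _; rewrite row0.
have hx : x *m (W *m W^T) = 0 by apply/sub_kermxP/row_sub.
have : fnorm2 (x *m W) = 0.
  by rewrite -fnorm2_trmx fnorm2_tr trmxK trmx_mul mulmxA -(mulmxA x) hx
             mul0mx mxtrace0.
by move/fnorm2_eq0/eqP; rewrite mulmx_free_eq0 // => /eqP.
Qed.

(** The witness is [W^T (W W^T)^-1 W] for a row basis [W], whose Gram matrix is
    invertible because the sum of squares is definite ([gram_unit]). *)
Lemma row_space_projector m n (B : 'M[R]_(m, n)) :
  exists Pi : 'M[R]_n,
    [/\ projector Pi, B *m Pi = B & \tr Pi = (\rank B)%:R].
Proof.
have uW := gram_unit (row_base_free B).
have BW : (B <= row_base B)%MS by rewrite eq_row_base.
move: (\rank B) (row_base B) uW BW => q W uW /submxP[D ->].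
exists (W^T *m (invmx (W *m W^T) *m W)); split.
- split; first by rewrite !trmx_mul trmx_inv trmx_mul !trmxK -mulmxA.
  by rewrite -!mulmxA (mulmxA W) (mulKVmx uW).
- by rewrite -!mulmxA (mulmxA W) (mulKVmx uW).
- by rewrite mxtrace_mulC -mulmxA mulVmx // mxtrace1.
Qed.

(** Let [t] separate the first [q] values of [s] from the others: trading
    weight on the latter for missing weight on the former gains at least [t]
    per unit, and there is no more weight to place than [q]. *)
Lemma weighted_sum_le_top n q (s w : 'I_n -> R) :
  (q <= n)%N -> (forall j, 0 <= s j) ->
  (forall j j' : 'I_n, (j <= j')%N -> s j' <= s j) ->
  (forall j, 0 <= w j <= 1) -> \sum_j w j <= q%:R ->
  \sum_j s j * w j <= \sum_(j < n | (j < q)%N) s j.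
Proof.
move=> qn s0 sd w01 wq.
have [t [t0 tl tr]] : exists t, [/\ 0 <= t,
    forall j : 'I_n, (j < q)%N -> t <= s j &
    forall j : 'I_n, (q <= j)%N -> s j <= t].
  have [qn'|nq] := ltnP q n.
    exists (s (Ordinal qn')); split=> // j hj; apply: sd => //=.
    exact: ltnW.
  by exists 0; split=> // j hj; have := ltn_ord j; lia.
have cq : \sum_(j < n | (j < q)%N) (1 : R) = q%:R.
  by rewrite -(big_ord_widen _ (fun=> 1)) // sumr_const card_ord.
have h : \sum_j s j * w j - \sum_(j < n | (j < q)%N) s j
   <= t * (\sum_j w j - \sum_(j < n | (j < q)%N) (1 : R)).
  rewrite !(big_mkcond (fun j : 'I_n => (j < q)%N)) -!sumrB mulr_sumr.
  apply: ler_sum => j _; have /andP[w0 w1] := w01 j.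
  by case: ltnP => hj; [have := tl _ hj|have := tr _ hj]; nra.
rewrite cq in h; nra.
Qed.

(** With [Pi] the projector onto the row space of [B], both [|A V V^T|^2] and
    [|A Pi|^2] are weighted sums of the squared singular values of [A], and the
    former collects the [q] largest ones; [A (1 - Pi)] does not see [B]. *)
Lemma Eckart_Young m n q (A B : 'M[R]_(m, n)) (V : 'M[R]_(n, q)) :
  is_svdR A V -> (\rank B <= q)%N ->
  fnorm2 (A *m (1%:M - V *m V^T)) <= fnorm2 (A - B).
Proof.
move=> [qn [L [S [Q [[LL QQ eA S0 [Sp Sd]] eV]]]]] rB.
pose s j := \sum_(i < m) S i j ^+ 2.
have SS : S^T *m S = diag_mx (\row_j s j).
  apply/matrixP => j j'; rewrite !mxE.
  case: eqVneq => [<-|jj']; last first.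
    rewrite mulr0n big1 // => i _; rewrite mxE.
    have [e|ne] := eqVneq (i : nat) j; last by rewrite S0 // mul0r.
    by rewrite (S0 i j') ?mulr0 // e.
  by rewrite mulr1n; apply: eq_bigr => i _; rewrite mxE expr2.
have s0 j : 0 <= s j by apply: sumr_ge0 => i _; apply: sqr_ge0.
have sE (i : 'I_m) (j : 'I_n) : i = j :> nat -> s j = S i j ^+ 2.
  move=> e; rewrite /s (bigD1 i) //= big1 ?addr0 // => k ki.
  by rewrite S0 ?expr0n // -e.
have sd (j j' : 'I_n) : (j <= j')%N -> s j' <= s j.
  move=> jj'; have [jm|mj] := ltnP j' m; last first.
    rewrite {1}/s big1 // => i _; rewrite S0 ?expr0n //.
    by have := ltn_ord i; lia.
  have jm' : (j < m)%N by lia.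
  rewrite (sE (Ordinal jm)) // (sE (Ordinal jm')) //.
  by apply: lerXn2r; rewrite ?nnegrE ?Sp ?Sd.
have QQ' : Q *m Q^T = 1%:M by apply: mulmx1C.
have key Pi : projector Pi ->
    fnorm2 (A *m Pi) = \sum_j s j * (Q^T *m Pi *m Q) j j.
  move=> hPi; rewrite fnorm2_mul_projector //.
  have -> : A^T *m A = Q *m diag_mx (\row_j s j) *m Q^T.
    by rewrite -SS eA !trmx_mul trmxK !mulmxA -(mulmxA _ L^T) LL mulmx1.
  rewrite -!mulmxA mxtrace_mulC -!mulmxA.
  rewrite /mxtrace; apply: eq_bigr => j _; rewrite mul_diag_mx mxE mxE.
  by rewrite mulmxA.
have hV : V^T *m V = 1%:M.
  rewrite eV; apply/matrixP => a b; rewrite !mxE.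
  move/matrixP: QQ => /(_ (widen_ord qn a) (widen_ord qn b)); rewrite !mxE.
  move=> <-; by apply: eq_bigr => k _; rewrite !mxE.
have kV : fnorm2 (A *m (V *m V^T)) = \sum_(j < n | (j < q)%N) s j.
  rewrite key; last exact: projector_gram.
  rewrite [RHS]big_mkcond; apply: eq_bigr => j _.
  have QV (k : 'I_n) (a : 'I_q) : (Q^T *m V) k a = (k == a :> nat)%:R.
    move/matrixP: QQ => /(_ k (widen_ord qn a)); rewrite !mxE => <-.
    by apply: eq_bigr => l _; rewrite eV !mxE.
  have -> : Q^T *m (V *m V^T) *m Q = (Q^T *m V) *m (Q^T *m V)^T.
    by rewrite trmx_mul trmxK !mulmxA.
  rewrite mxE; under eq_bigr => a _ do rewrite [X in _ * X]mxE !QV.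
  case: ltnP => jq.
    rewrite (bigD1 (Ordinal jq)) //= eqxx big1 ?addr0 ?mulr1 // => i.
    by rewrite -val_eqE eq_sym /= => /negbTE ->; rewrite mul0r.
  rewrite big1 ?mulr0 // => i _; case: eqP => [e|]; last by rewrite mul0r.
  by have := ltn_ord i; lia.
have [Pi [hPi BPi tPi]] := row_space_projector B.
have kPi : fnorm2 (A *m Pi) <= fnorm2 (A *m (V *m V^T)).
  rewrite kV key //; apply: weighted_sum_le_top => //.
    move=> j; apply: projector_diag; case: hPi => hT hI; split.
      by rewrite !trmx_mul trmxK hT mulmxA.
    by rewrite !mulmxA -(mulmxA _ Q) QQ' mulmx1 -(mulmxA _ Pi Pi) hI.
  have -> : \sum_j (Q^T *m Pi *m Q) j j = \tr Pi.
    by rewrite -[LHS]/(\tr _) mxtrace_mulC mulmxA QQ' mul1mx.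
  by rewrite tPi ler_nat.
have -> : fnorm2 (A *m (1%:M - V *m V^T)) = fnorm2 A - fnorm2 (A *m (V *m V^T)).
  rewrite -[fnorm2 A](fnorm2_pythagoras A (projector_gram hV)).
  by rewrite [RHS]addrAC subrr add0r.
apply: (@le_trans _ _ (fnorm2 (A *m (1%:M - Pi)))).
  by have := fnorm2_pythagoras A hPi; lra.
have -> : A *m (1%:M - Pi) = (A - B) *m (1%:M - Pi).
  by rewrite mulmxBl [B *m _]mulmxBr mulmx1 BPi subrr subr0.
exact/fnorm2_projector_le/projectorC.
Qed.

Lemma is_svdR_orthonormal m n q (A : 'M[R]_(m, n)) (V : 'M[R]_(n, q)) :
  is_svdR A V -> V^T *m V = 1%:M.
Proof.
move=> [qn [L [S [Q [[_ QQ _ _ _] ->]]]]]; apply/matrixP => a b.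
move/matrixP: QQ => /(_ (widen_ord qn a) (widen_ord qn b)); rewrite !mxE.
by move=> <-; apply: eq_bigr => k _; rewrite !mxE.
Qed.

Lemma is_svdL_trmx m n q (A : 'M[R]_(m, n)) (U : 'M[R]_(m, q)) :
  is_svdL A U -> is_svdR A^T U.
Proof.
move=> [qm [L [S [Q [[LL QQ eA S0 [Sp Sd]] eU]]]]].
exists qm, Q, S^T, L; split=> //; split=> //.
- by rewrite eA !trmx_mul trmxK mulmxA.
- by move=> i j ij; rewrite mxE S0 // eq_sym.
- split=> [i j e|i i' j j' e e' h]; rewrite !mxE; first exact: Sp.
  by apply: Sd => //; lia.
Qed.

Lemma is_svdL_orthonormal m n q (A : 'M[R]_(m, n)) (U : 'M[R]_(m, q)) :
  is_svdL A U -> U^T *m U = 1%:M.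
Proof. by move/is_svdL_trmx/is_svdR_orthonormal. Qed.

Lemma is_svdL_low_rank m n q (A : 'M[R]_(m, n)) (U : 'M[R]_(m, q)) :
  is_svdL A U -> (\rank A <= q)%N -> U *m (U^T *m A) = A.
Proof.
move=> hU rA; have := Eckart_Young (is_svdL_trmx hU) (B := A^T).
rewrite mxrank_tr => /(_ rA); rewrite subrr.
have -> : fnorm2 (0 : 'M[R]_(n, m)) = 0 by rewrite fnorm2_tr mulmx0 mxtrace0.
move=> h; have /fnorm2_eq0 : fnorm2 (A^T *m (1%:M - U *m U^T)) = 0.
  by apply/eqP; rewrite eq_le h fnorm2_ge0.
rewrite mulmxBr mulmx1 => /subr0_eq /(congr1 trmx).
by rewrite !trmx_mul !trmxK mulmxA => <-.
Qed.

(** Off the range of [V], [A] differs from [A + E] by at most [E], and [A + E]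
    leaves a best rank [q] residual there, for which [A] is a competitor. *)
Lemma low_rank_residual m n q (A E : 'M[R]_(m, n)) (V : 'M[R]_(n, q)) :
  is_svdR (A + E) V -> (\rank A <= q)%N ->
  fnorm2 (A *m (1%:M - V *m V^T)) <= 4 * fnorm2 E.
Proof.
move=> hV rA; set Pi := 1%:M - _.
have hPi : projector Pi.
  exact/projectorC/projector_gram/(is_svdR_orthonormal hV).
have -> : A *m Pi = (A + E) *m Pi - E *m Pi by rewrite mulmxDl addrK.
apply: le_trans (fnorm2B _ _) _.
have := Eckart_Young hV rA; rewrite -/Pi [A + E - A]addrC addKr.
by have := fnorm2_projector_le E hPi; lra.
Qed.

(** A [sinTheta] below 1 rules out the junk value of [singular_value], hence
    provides a decomposition whose smallest singular value is bounded below. *)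
Lemma sinTheta_lower_bound m q n (U Ut : 'M[R]_(m, q)) (M : 'M[R]_(q, n)) c0 :
  (0 < q)%N -> 0 < c0 < 1 -> sinTheta U Ut <= c0 ->
  (1 - c0 ^+ 2) * fnorm2 M <= fnorm2 (U^T *m Ut *m M).
Proof.
move=> q0 /andP[c0p c01]; rewrite /sinTheta; set s := singular_value _ _ => hs.
have hs2 : 1 - c0 ^+ 2 <= s ^+ 2.
  rewrite lerBlDr addrC -lerBlDr.
  have [h|h] := lerP (1 - s ^+ 2) 0; first by nra.
  by rewrite -(sqr_sqrtr (ltW h)) lerXn2r ?nnegrE ?sqrtr_ge0 // ltW.
apply: (@le_trans _ _ (s ^+ 2 * fnorm2 M)).
  by rewrite ler_wpM2r ?fnorm2_ge0.
move: hs2; rewrite /s /singular_value; case: xgetP => [t -> |]; last first.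
  by rewrite expr0n /=; nra.
move=> [L [S [Q [[LL QQ eA S0 [Sp Sd]] [a [b [ea eb ->]]]]]]] _.
have QQ' : Q *m Q^T = 1%:M by apply: mulmx1C.
rewrite eA -!mulmxA fnorm2_isoL // -(@fnorm2_isoL _ _ _ Q^T M) ?trmxK //.
set N := Q^T *m M; rewrite /fnorm2 mulr_sumr; apply: ler_sum => i _.
rewrite mulr_sumr; apply: ler_sum => j _.
have -> : (S *m N) i j = S i i * N i j.
  rewrite mxE (bigD1 i) //= big1 ?addr0 // => k ki.
  by rewrite S0 ?mul0r // eq_sym.
rewrite exprMn ler_wpM2r ?sqr_ge0 //.
apply: lerXn2r; rewrite ?nnegrE; [apply: Sp; lia|exact: Sp|apply: Sd => //; first lia].
by have := ltn_ord i; lia.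
Qed.

End Frobenius.

(** * Flat indices and tensor-train interfaces *)

Section FlatSums.

Lemma big_ord_mul (R : nmodType) m n (F : nat -> R) :
  \sum_(y < m * n) F y = \sum_(i < m) \sum_(j < n) F (i * n + j)%N.
Proof.
rewrite pair_big /= (reindex (@mxtens_index m n)) //=.
by exists (@mxtens_unindex m n) => y _; rewrite ?mxtens_indexK ?mxtens_unindexK.
Qed.

Lemma big_ord_mul_col (R : nmodType) m n (F : nat -> R) :
  \sum_(y < m * n) F y = \sum_(i < m) \sum_(j < n) F (i + m * j)%N.
Proof.
rewrite exchange_big mulnC big_ord_mul; do 2!apply: eq_bigr => ? _.
by rewrite addnC mulnC.
Qed.

Lemma sum_delta (R : nzSemiRingType) n (k : nat) (F : nat -> R) : (k < n)%N ->
  \sum_(i < n) (k == i)%:R * F i = F k.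
Proof.
move=> kn; rewrite (bigD1 (Ordinal kn)) //= eqxx mul1r big1 ?addr0 // => i.
by rewrite -val_eqE eq_sym /= => /negbTE ->; rewrite mul0r.
Qed.

Lemma modn_addM m a y : (a < m)%N -> ((a + m * y) %% m)%N = a.
Proof. by move=> am; rewrite addnC mulnC modnMDl modn_small. Qed.

Lemma divn_addM m a y : (a < m)%N -> ((a + m * y) %/ m)%N = y.
Proof.
by move=> am; rewrite addnC mulnC divnMDl ?divn_small ?addn0 //; lia.
Qed.

Lemma modn_Madd q x s : (s < q)%N -> ((x * q + s) %% q)%N = s.
Proof. by move=> sq; rewrite modnMDl modn_small. Qed.

Lemma divn_Madd q x s : (s < q)%N -> ((x * q + s) %/ q)%N = x.
Proof. by move=> sq; rewrite divnMDl ?divn_small ?addn0 //; lia. Qed.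

End FlatSums.

Section FunctionMatrices.
Variable R : realType.

(** Matrices presented by functions on [nat]: a change of shape along a
    propositional equality then leaves the function untouched. *)
Definition mxf m n (f : nat -> nat -> R) : 'M[R]_(m, n) :=
  \matrix_(i < m, j < n) f i j.

Definition entry m n (A : 'M[R]_(m, n)) (i j : nat) : R :=
  if insub i is Some i' then if insub j is Some j' then A i' j' else 0 else 0.

Lemma entryE m n (A : 'M[R]_(m, n)) (i : 'I_m) (j : 'I_n) :
  entry A i j = A i j.
Proof. by rewrite /entry !valK. Qed.

Lemma entryK m n (A : 'M[R]_(m, n)) : mxf m n (entry A) = A.
Proof. by apply/matrixP => i j; rewrite mxE entryE. Qed.

Lemma entry_mxf m n f i j : (i < m)%N -> (j < n)%N -> entry (mxf m n f) i j = f i j.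
Proof.
by move=> im jn; rewrite -[i]/(val (Ordinal im)) -[j]/(val (Ordinal jn)) entryE mxE.
Qed.

Lemma recast_id m n (A : 'M[R]_(m, n)) : recast m n A = A.
Proof. exact: conform_mx_id. Qed.

Lemma recast_mxf m n m' n' f :
  m = m' -> n = n' -> recast m' n' (mxf m n f) = mxf m' n' f.
Proof. by move=> <- <-; rewrite recast_id. Qed.

Lemma rank_recast m n m' n' (A : 'M[R]_(m, n)) :
  m = m' -> n = n' -> \rank (recast m' n' A) = \rank A.
Proof. by move=> <- <-; rewrite recast_id. Qed.

Lemma recast_gram m n m' (A : 'M[R]_(m, n)) :
  m = m' -> (recast m' n A)^T *m recast m' n A = A^T *m A.
Proof. by move=> <-; rewrite recast_id. Qed.

Lemma eq_mxf m n f g :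
  (forall i j, (i < m)%N -> (j < n)%N -> f i j = g i j) -> mxf m n f = mxf m n g.
Proof. by move=> h; apply/matrixP => i j; rewrite !mxE h. Qed.

Lemma mulmx_mxf m n q f g :
  mxf m n f *m mxf n q g = mxf m q (fun i j => \sum_(k < n) f i k * g k j).
Proof.
by apply/matrixP => i j; rewrite !mxE; apply: eq_bigr => k _; rewrite !mxE.
Qed.

Lemma trmx_mxf m n f : (mxf m n f)^T = mxf n m (fun i j => f j i).
Proof. by apply/matrixP => i j; rewrite !mxE. Qed.

Lemma tens_mxf m n q s f g : mxf m n f *t mxf q s g =
  mxf (m * q) (n * s) (fun i j =>
    f (i %/ q)%N (j %/ s)%N * g (i %% q)%N (j %% s)%N).
Proof.
apply/matrixP => i j; case: (mxtens_indexP i) => i1 i2.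
case: (mxtens_indexP j) => j1 j2; rewrite tensmxE !mxE /=.
by rewrite !(addnC (_ * _)%N) ![(_ * q)%N]mulnC ![(_ * s)%N]mulnC
           !modn_addM ?divn_addM.
Qed.

Lemma scalar_mxf n : 1%:M = mxf n n (fun i j => (i == j)%:R).
Proof. by apply/matrixP => i j; rewrite !mxE. Qed.

Lemma reshape_mxf m n m' n' f : (m * n = m' * n')%N ->
  Defs.reshape m' n' (mxf m n f) =
  mxf m' n' (fun i j => f ((i + m' * j) %% m)%N ((i + m' * j) %/ m)%N).
Proof.
move=> e; apply/matrixP => i j; rewrite !mxE.
set q := (i + m' * j)%N.
have qlt : (q < m * n)%N.
  rewrite e /q; have := ltn_ord i; have := ltn_ord j; nia.
have m0 : (0 < m)%N by case: (m) qlt => //; lia.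
have am : (q %% m < m)%N by rewrite ltn_mod.
have bn : (q %/ m < n)%N by rewrite ltn_divLR // mulnC.
have cond (a : 'I_m) (b : 'I_n) : ((a + b * m)%N == (i + j * m')%N) =
    (a == Ordinal am) && (b == Ordinal bn).
  rewrite -!val_eqE /= [(j * m')%N]mulnC -/q; apply/eqP/andP => [<-|[/eqP -> /eqP ->]].
    by rewrite [(b * m)%N]mulnC modn_addM ?divn_addM.
  by rewrite addnC -divn_eq.
rewrite (bigD1 (Ordinal am)) //= [X in _ + X]big1 ?addr0; last first.
  by move=> a /negbTE na; rewrite big_pred0 // => b; rewrite cond na.
rewrite (eq_bigl (fun b => b == Ordinal bn)); last first.
  by move=> b; rewrite (cond (Ordinal am)) eqxx.
by rewrite big_pred1_eq mxE.
Qed.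

Lemma fnorm2_mxf m n f :
  fnorm2 (mxf m n f) = \sum_(i < m) \sum_(j < n) f i j ^+ 2.
Proof. by do 2!apply: eq_bigr => ? _; rewrite mxE. Qed.

(** Multiplying by [M (x) I_p] acts on the slow part of the column index only,
    so the fast part may be moved to the rows beforehand. *)
Lemma fnorm2_mul_tens1 m n p q f (M : 'M[R]_(n, q)) : (0 < p)%N ->
  fnorm2 (mxf m (n * p) f *m (M *t (1%:M : 'M[R]_p))) =
  fnorm2 (mxf (p * m) n (fun y b => f (y %% m)%N (y %/ m + p * b)%N) *m M).
Proof.
move=> p0; rewrite -(entryK M) scalar_mxf tens_mxf !mulmx_mxf !fnorm2_mxf.
rewrite (big_ord_mul p m (fun y => \sum_(j < q) (\sum_(k < n)
  f (y %% m)%N (y %/ m + p * k)%N * entry M k j) ^+ 2)).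
rewrite [RHS]exchange_big /=; apply: eq_bigr => i _.
rewrite (big_ord_mul q p (fun y => (\sum_(k < n * p) f i k *
  (entry M (k %/ p)%N (y %/ p)%N * ((k %% p)%N == (y %% p)%N)%:R)) ^+ 2)).
rewrite exchange_big /=; apply: eq_bigr => x _; apply: eq_bigr => j _.
congr (_ ^+ 2).
rewrite (big_ord_mul n p (fun k => f i k * (entry M (k %/ p)%N
  ((j * p + x) %/ p)%N * ((k %% p)%N == ((j * p + x) %% p)%N)%:R))).
apply: eq_bigr => b _.
rewrite ![(_ * p + _)%N]addnC ![(_ * p)%N]mulnC ![(_ * m + _)%N]addnC.
rewrite ![(_ * m)%N]mulnC modn_addM // divn_addM // modn_addM // divn_addM //.
rewrite -(sum_delta (fun y => f i (y + p * b)%N * entry M b j) (ltn_ord x)).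
apply: eq_bigr => y _; rewrite [(p * b + y)%N]addnC modn_addM // divn_addM //.
by rewrite eq_sym mulrA mulrC.
Qed.

End FunctionMatrices.

Section FlatTensors.
Variables (R : realType) (p d : nat).
Hypothesis p0 : (0 < p)%N.

(** Column-major position. All sequential unfoldings, and the reshapings between
    them, keep the position of an entry, so that a tensor may be replaced by one
    function of the position. *)
Definition flat_index (i : midx p d) : nat := (\sum_(t < d) i t * p ^ t)%N.

Definition flat (X : tensor R p d) (m : nat) : R :=
  \sum_(i : midx p d | flat_index i == m) X i.

Lemma digits_lt k (f : nat -> nat) : (forall t, f t < p)%N ->
  (\sum_(t < k) f t * p ^ t < p ^ k)%N.
Proof.
move=> hf; elim: k => [|k ih]; first by rewrite big_ord0.
rewrite big_ord_recr /= expnS; apply: leq_trans (leq_mul (hf k) (leqnn _)).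
by rewrite mulSn -addSn leq_add2r.
Qed.

Lemma digits_split k (f : nat -> nat) : (k <= d)%N ->
  (\sum_(t < d) f t * p ^ t =
   \sum_(t < d | (t < k)%N) f t * p ^ t +
   p ^ k * \sum_(t < d | (k <= t)%N) f t * p ^ (t - k))%N.
Proof.
move=> kd; rewrite (bigID (fun t : 'I_d => (t < k)%N)) /=; congr (_ + _)%N.
rewrite big_distrr /=; apply: eq_big => [t|t]; first by rewrite -leqNgt.
rewrite -leqNgt => kt.
have -> : (p ^ t = p ^ k * p ^ (t - k))%N by rewrite -expnD subnKC.
by rewrite mulnCA.
Qed.

Definition coordinate (i : midx p d) (t : nat) : nat :=
  if insub t is Some t' then i t' else 0%N.

Lemma coordinate_lt i t : (coordinate i t < p)%N.
Proof. by rewrite /coordinate; case: insubP. Qed.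

Lemma coordinateE i (t : 'I_d) : coordinate i t = i t.
Proof. by rewrite /coordinate valK. Qed.

Lemma flat_indexE (i : midx p d) : flat_index i = (\sum_(t < d) coordinate i t * p ^ t)%N.
Proof. by apply: eq_bigr => t _; rewrite coordinateE. Qed.

Lemma low_part_lt k (i : midx p d) : (k <= d)%N ->
  (\sum_(t < d | (t < k)%N) coordinate i t * p ^ t < p ^ k)%N.
Proof.
move=> kd; rewrite -(big_ord_widen _ (fun t => coordinate i t * p ^ t)%N) //.
by apply: digits_lt => t; apply: coordinate_lt.
Qed.

Lemma flat_index_lt (i : midx p d) : (flat_index i < p ^ d)%N.
Proof. by rewrite flat_indexE; apply: digits_lt => t; apply: coordinate_lt. Qed.

Lemma unfold_cond k a b (i : midx p d) : (k <= d)%N -> (a < p ^ k)%N ->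
  ((\sum_(t < d | (t < k)%N) i t * p ^ t == a)%N &&
   (\sum_(t < d | (k <= t)%N) i t * p ^ (t - k) == b)%N) =
  (flat_index i == a + p ^ k * b)%N.
Proof.
move=> kd ak; rewrite flat_indexE (digits_split _ kd).
have := low_part_lt i kd.
rewrite (eq_bigr (fun t : 'I_d => i t * p ^ t)%N) => [lo|t _]; last first.
  by rewrite coordinateE.
rewrite [X in (_ + _ * X)%N](eq_bigr (fun t : 'I_d => i t * p ^ (t - k))%N);
  last by move=> t _; rewrite coordinateE.
apply/andP/eqP => [[/eqP -> /eqP ->] //|e]; split; apply/eqP.
  by rewrite -(modn_addM (\sum_(t < d | (k <= t)%N) i t * p ^ (t - k))%N lo) e
             modn_addM.
by rewrite -[LHS](divn_addM _ lo) e divn_addM.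
Qed.

Lemma unfoldE k X : (k <= d)%N ->
  unfold k X = mxf (p ^ k) (p ^ (d - k)) (fun a b => flat X (a + p ^ k * b)%N)
  :> 'M[R]_(_, _).
Proof.
move=> kd; apply/matrixP => a b; rewrite !mxE; apply: eq_bigl => i.
exact: unfold_cond.
Qed.

Lemma digit_flat_index (i : midx p d) (t : 'I_d) : (flat_index i %/ p ^ t %% p)%N = i t.
Proof.
have td : (t <= d)%N by apply: ltnW.
rewrite flat_indexE (digits_split _ td) divn_addM ?low_part_lt //.
rewrite (bigD1 t) //= subnn expn0 muln1 coordinateE.
rewrite (eq_bigr (fun u : 'I_d => p * (coordinate i u * p ^ (u - t).-1))%N).
  by rewrite -big_distrr /= modn_addM.
move=> u /andP[tu ut]; rewrite -[(u - t)%N]prednK; last first.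
  by rewrite subn_gt0 ltn_neqAle eq_sym -val_eqE tu andbT in ut *.
by rewrite /= expnS; nia.
Qed.

Lemma flat_index_inj : injective flat_index.
Proof.
move=> i j e; apply/ffunP => t; apply/val_inj.
by rewrite /= -!digit_flat_index e.
Qed.

Lemma flat_flat_index X i : flat X (flat_index i) = X i.
Proof.
rewrite /flat (eq_bigl (fun j => j == i)) ?big_pred1_eq // => j.
by apply/eqP/eqP => [/flat_index_inj|->].
Qed.

Let to_ord (i : midx p d) : 'I_(p ^ d) := Ordinal (flat_index_lt i).

Let to_ord_bij : bijective to_ord.
Proof.
apply: inj_card_bij; last by rewrite card_ffun !card_ord.
by move=> i j /(congr1 val) /= /flat_index_inj.
Qed.

Lemma flat_index_surj m : (m < p ^ d)%N -> exists i, flat_index i = m.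
Proof.
move=> hm; have [g _ gK] := to_ord_bij; exists (g (Ordinal hm)).
by have := congr1 val (gK (Ordinal hm)).
Qed.

Lemma sum_flat_index (V : nmodType) (F : nat -> V) :
  \sum_(m < p ^ d) F m = \sum_(i : midx p d) F (flat_index i).
Proof. by rewrite (reindex to_ord) //; apply: onW_bij. Qed.

Lemma flatE X m (pos : forall t, (m %/ p ^ t %% p < p)%N) : (m < p ^ d)%N ->
  flat X m = X [ffun t : 'I_d => Ordinal (pos t)].
Proof.
case/flat_index_surj => i e; rewrite -{1}e flat_flat_index; congr X.
apply/ffunP => t; rewrite ffunE; apply/val_inj => /=.
by rewrite -digit_flat_index e.
Qed.

Lemma fnorm2_distE X Y : fnorm2_dist X Y =
  \sum_(m < p ^ d) (flat X m - flat Y m) ^+ 2.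
Proof.
rewrite (sum_flat_index (fun m => (flat X m - flat Y m) ^+ 2)).
by apply: eq_bigr => i _; rewrite !flat_flat_index.
Qed.

End FlatTensors.

Section Interfaces.
Variables (R : realType) (p : nat) (r : nat -> nat).
Hypothesis p0 : (0 < p)%N.

(** [A k x b c] is the entry (b, c) of the [k]th core at the state [x]. The
    indices are plain numbers, so that cores of all sizes share one type; only
    the values at indices in range matter. *)
Definition cores := nat -> nat -> nat -> nat -> R.
Implicit Types A B : cores.

(** Contraction of the first [k] cores, at the position [a] of their states,
    with the last bond [b] open. *)
Fixpoint lpart A k (a b : nat) : R :=
  if k is k'.+1 then
    \sum_(s < r k') lpart A k' (a %% p ^ k')%N s * A k (a %/ p ^ k')%N s b
  else 1.

(** Contraction of the [m] cores from the [k]th on, with the first bond open. *)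
Fixpoint rpart A m k (b s : nat) : R :=
  if m is m'.+1 then
    \sum_(t < r k) rpart A m' k.+1 (b %/ p)%N t * A k (b %% p)%N s t
  else 1.

Lemma eq_lpart A B k a b : (a < p ^ k)%N -> (b < r k)%N ->
  (forall j x s t, (1 <= j <= k)%N -> (x < p)%N -> (s < r j.-1)%N ->
     (t < r j)%N -> A j x s t = B j x s t) ->
  lpart A k a b = lpart B k a b.
Proof.
elim: k a b => //= k ih a b ha hb h; apply: eq_bigr => s _; congr (_ * _).
  apply: ih => //; first by rewrite ltn_mod expn_gt0 p0.
  by move=> j x ? ? hj *; apply: h => //; lia.
by apply: h => //=; rewrite ?leqnn // ltn_divLR ?expn_gt0 ?p0 // -expnS.
Qed.

Lemma eq_rpart A B m k b s : (b < p ^ m)%N -> (s < r k.-1)%N ->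
  (forall j x s t, (k <= j < k + m)%N -> (x < p)%N -> (s < r j.-1)%N ->
     (t < r j)%N -> A j x s t = B j x s t) ->
  rpart A m k b s = rpart B m k b s.
Proof.
elim: m k b s => //= m ih k b s hb hs h; apply: eq_bigr => t _; congr (_ * _).
  apply: ih => //=; first by rewrite ltn_divLR // -expnSr.
  by move=> j x ? ? hj *; apply: h => //; lia.
by apply: h => //; rewrite ?ltn_mod //; lia.
Qed.

(** Moving one core from the left part to the right part shifts the cut by one
    bond, starting from the cut after the last core. *)
Lemma lpart_cut A d k m a b : r d = 1%N -> (k + m)%N = d ->
  (a < p ^ k)%N -> (b < p ^ m)%N ->
  lpart A d (a + p ^ k * b)%N 0 =
  \sum_(s < r k) lpart A k a s * rpart A m k.+1 b s.
Proof.
move=> rd; elim: m k a b => [|m ih] k a b kd ha hb.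
  move: kd rd; rewrite addn0 => -> rd; rewrite rd big_ord1 /= mulr1.
  by move: hb; rewrite expn0 ltnS leqn0 => /eqP ->; rewrite muln0 addn0.
have hx : (a + p ^ k * (b %% p) < p ^ k.+1)%N.
  rewrite expnS; apply: leq_trans (leq_mul (ltn_pmod b p0) (leqnn _)).
  by rewrite mulSn mulnC -addSn leq_add2r.
have hb' : (b %/ p < p ^ m)%N by rewrite ltn_divLR // -expnSr.
have -> : (a + p ^ k * b = a + p ^ k * (b %% p) + p ^ k.+1 * (b %/ p))%N.
  by rewrite {1}(divn_eq b p) expnS; nia.
rewrite ih //; last by rewrite -kd addnS.
under eq_bigr => t _ do rewrite /= modn_addM // divn_addM // mulr_suml.
rewrite exchange_big /=; apply: eq_bigr => s _; rewrite mulr_sumr.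
by apply: eq_bigr => t _; rewrite -!mulrA [A _ _ _ _ * _]mulrC.
Qed.

End Interfaces.

(** * The factors and residuals of the algorithm as interfaces *)

Lemma tens1 (R : comPzRingType) m n :
  (1%:M : 'M[R]_m) *t (1%:M : 'M[R]_n) = 1%:M.
Proof.
apply/matrixP => i j; case: (mxtens_indexP i) => i1 i2.
case: (mxtens_indexP j) => j1 j2; rewrite tensmxE !mxE.
by rewrite (can_eq (@mxtens_indexK m n)) xpair_eqE -natrM mulnb.
Qed.

Lemma tensmxBl (R : comPzRingType) m n q s (A B : 'M[R]_(m, n))
    (C : 'M[R]_(q, s)) : (A - B) *t C = A *t C - B *t C.
Proof. by apply/matrixP => i j; rewrite !mxE mulrBl. Qed.

Lemma gram_const1 (R : realType) n : n = 1%N ->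
  let A := mxf 1 n (fun _ _ => 1 : R) in A^T *m A = 1%:M.
Proof.
by move=> -> /=; apply/matrixP => i j; rewrite !mxE big_ord1 !mxE !ord1 mulr1.
Qed.

Lemma sum_ord1 (R : nmodType) n (F : nat -> R) : n = 1%N -> \sum_(i < n) F i = F 0%N.
Proof. by move=> ->; rewrite big_ord1. Qed.

Section LeftFactors.
Variables (R : realType) (p d : nat) (r : nat -> nat).
Hypotheses (p0 : (0 < p)%N) (r0 : r 0%N = 1%N).
Implicit Types (U : left_family R p r).

Definition left_cores U : cores R :=
  fun k x s t => entry (U k) (x * r k.-1 + s) t.
Lemma prodLE U k : (0 < k)%N ->
  prodL U k = mxf (p ^ k) (r k) (lpart p r (left_cores U) k).
Proof.
case: k => // k _; elim: k => [|k ih].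
  rewrite /= -[U 1%N]entryK recast_mxf //; last by rewrite r0 muln1 expn1.
  apply: eq_mxf => a c ha hc.
  rewrite /= (sum_ord1 (fun s => 1 * left_cores U 1 (a %/ p ^ 0)%N s c) r0) mul1r.
  by rewrite /left_cores /= expn0 divn1 addn0; congr entry; rewrite r0 muln1.
rewrite [LHS]/= -/(prodL U k.+1) ih -[U k.+2]entryK scalar_mxf tens_mxf.
rewrite mulmx_mxf recast_mxf; [|by rewrite [RHS]expnS|by []].
apply: eq_mxf => a c ha hc.
rewrite (big_ord_mul p (r k.+1) (fun y =>
  (a %/ p ^ k.+1 == y %/ r k.+1)%N%:R *
  lpart p r (left_cores U) k.+1 (a %% p ^ k.+1)%N (y %% r k.+1)%N *
  entry (U k.+2) y c)).
have hx : (a %/ p ^ k.+1 < p)%N by rewrite ltn_divLR ?expn_gt0 ?p0 // -expnS.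
rewrite [RHS]/= -(sum_delta (fun x => \sum_(s < r k.+1)
  lpart p r (left_cores U) k.+1 (a %% p ^ k.+1)%N s *
  left_cores U k.+2 x s c) hx).
apply: eq_bigr => x _; rewrite mulr_sumr; apply: eq_bigr => s _.
by rewrite mulrA modn_Madd // divn_Madd.
Qed.

Lemma lpart_orthonormal U k :
  (forall j, (1 <= j <= k)%N -> (U j)^T *m U j = 1%:M) ->
  let L := mxf (p ^ k) (r k) (lpart p r (left_cores U) k) in
  L^T *m L = 1%:M.
Proof.
case: k => [_|k]; rewrite /=.
  exact: gram_const1.
rewrite -prodLE //; elim: k => [|k ih] hU.
  by rewrite [prodL U 1]/= recast_gram ?hU // r0 muln1 expn1.
rewrite [prodL U k.+2]/= -/(prodL U k.+1) recast_gram ?expnS //.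
rewrite trmx_mul mulmxA -(mulmxA (U k.+2)^T) trmx_tens tensmx_mul trmx1 mul1mx.
rewrite ih => [|j hj]; last by apply: hU; lia.
by rewrite tens1 mulmx1 hU // ltnS leqnn.
Qed.

(** The entries of the matrix [(I (x) U_prod^T) [x]_k] of the first [k - 1] left
    factors applied to an unfolding. *)
Definition projected (A : cores R) (x : nat -> R) k (y c : nat) : R :=
  \sum_(a < p ^ k.-1) lpart p r A k.-1 a (y %% r k.-1)%N *
     x (a + p ^ k.-1 * (y %/ r k.-1) + p ^ k * c)%N.

Lemma init_targetE X U k : (1 <= k < d)%N ->
  init_target X U k = mxf (p * r k.-1) (p ^ (d - k))
    (projected (left_cores U) (flat X) k).
Proof.
case: k => // k /andP[_ kd]; rewrite /init_target; case: eqVneq => [k0|kn0].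
  case: k k0 kd => // _ kd; rewrite unfoldE ?(ltnW kd) // recast_mxf //; last first.
    by rewrite /= r0 muln1 expn1.
  apply: eq_mxf => y c hy hc; rewrite /projected /= (sum_ord1 (fun a => 1 *
    flat X (a + p ^ 0 * (y %/ r 0) + p ^ 1 * c)%N) (expn0 p)) mul1r.
  by rewrite r0 divn1 add0n expn0 mul1n.
rewrite /= prodLE; last by lia.
rewrite unfoldE ?(ltnW kd) // recast_mxf; [|by rewrite expnS|by []].
rewrite trmx_mxf scalar_mxf tens_mxf mulmx_mxf; apply: eq_mxf => y c hy hc.
rewrite (big_ord_mul p (p ^ k) (fun q =>
  (y %/ r k == q %/ p ^ k)%N%:R *
  lpart p r (left_cores U) k (q %% p ^ k)%N (y %% r k)%N *
  flat X (q + p ^ k.+1 * c)%N)).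
have rk0 : (0 < r k)%N by case: (r k) hy => //; rewrite muln0.
have hx : (y %/ r k < p)%N by rewrite ltn_divLR.
rewrite /projected /= -(sum_delta (fun x => \sum_(a < p ^ k)
  lpart p r (left_cores U) k a (y %% r k)%N *
  flat X (a + p ^ k * x + p ^ k.+1 * c)%N) hx).
apply: eq_bigr => x _; rewrite mulr_sumr; apply: eq_bigr => a _.
by rewrite mulrA addnC [(x * _)%N]mulnC modn_addM // divn_addM //.
Qed.


End LeftFactors.

Section RightFactors.
Variables (R : realType) (p d : nat) (r : nat -> nat).
Hypotheses (p0 : (0 < p)%N) (rd : r d = 1%N).
Implicit Types (V : right_family R p r).

Definition right_cores V : cores R :=
  fun k x s t => entry (V k) (t * p + x) s.

(** The recursion of [prodR] starts at its last factor; starting it at the empty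
    product instead lets the last mode be treated like the others. *)
Lemma rpart_step V m k :
  (mxf (p ^ m) (r k) (rpart p r (right_cores V) m k.+1) *t (1%:M : 'M[R]_p))
    *m V k =
  mxf (p ^ m * p) (r k.-1) (rpart p r (right_cores V) m.+1 k).
Proof.
rewrite -{1}[V k]entryK scalar_mxf tens_mxf mulmx_mxf.
apply: eq_mxf => b s hb hs.
rewrite (big_ord_mul (r k) p (fun y =>
  rpart p r (right_cores V) m k.+1 (b %/ p)%N (y %/ p)%N *
  (b %% p == y %% p)%N%:R * entry (V k) y s)).
rewrite [RHS]/=; apply: eq_bigr => t _.
rewrite -(sum_delta (fun x => rpart p r (right_cores V) m k.+1 (b %/ p)%N t *
  right_cores V k x s t) (ltn_pmod b p0)).
apply: eq_bigr => x _.
by rewrite modn_Madd // divn_Madd // mulrCA mulrA.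
Qed.

Lemma prodR_recE V m k : (k + m)%N = d ->
  prodR_rec V m k =
  mxf (p ^ m.+1) (r k.-1) (rpart p r (right_cores V) m.+1 k).
Proof.
elim: m k => [|m ih] k kd.
  have rk : r k = 1%N by rewrite -rd -kd addn0.
  rewrite /= -[V k]entryK recast_mxf //; last by rewrite rk mul1n expn1.
  apply: eq_mxf => b s hb hs.
  rewrite /= (sum_ord1 (fun t => 1 * right_cores V k (b %% p)%N s t) rk) mul1r.
  by rewrite /right_cores mul0n add0n modn_small.
rewrite [LHS]/= ih; last by rewrite addSnnS.
by rewrite rpart_step recast_mxf //; rewrite [RHS]expnSr.
Qed.

Lemma rpart_orthonormal V m k : (k + m = d.+1)%N -> (0 < k)%N ->
  (forall j, (k <= j <= d)%N -> (V j)^T *m V j = 1%:M) ->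
  let Q := mxf (p ^ m) (r k.-1) (rpart p r (right_cores V) m k) in
  Q^T *m Q = 1%:M.
Proof.
case: m => [|m] kd k0; rewrite /=.
  have -> : k.-1 = d by lia.
  by move=> _; exact: gram_const1.
have {}kd : (k + m)%N = d by lia.
rewrite -prodR_recE //; elim: m k k0 kd => [|m ih] k k0 kd hV.
  have kd' : k = d by rewrite -kd addn0.
  rewrite [prodR_rec _ _ _]/= recast_gram ?hV //; first by rewrite kd' leqnn.
  by rewrite kd' rd mul1n expn1.
rewrite [prodR_rec _ _ _]/= recast_gram ?expnSr //.
rewrite trmx_mul mulmxA -(mulmxA (V k)^T) trmx_tens tensmx_mul trmx1 mul1mx.
rewrite (ih k.+1) ?addSnnS // => [|j hj]; last by apply: hV; lia.
by rewrite tens1 mulmx1 hV //; lia.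
Qed.

End RightFactors.

Section Residuals.
Variables (R : realType) (p d : nat) (r : nat -> nat).
Hypotheses (p0 : (0 < p)%N) (r0 : r 0%N = 1%N).
Implicit Types (U : left_family R p r).

Lemma factor_init_target (X : tensor R p d) U k : (1 <= k < d)%N ->
  (U k)^T *m init_target X U k = mxf (r k) (p ^ (d - k)) (fun s b =>
    \sum_(a < p ^ k) lpart p r (left_cores U) k a s * flat X (a + p ^ k * b)%N)
  :> 'M[R]_(_, p ^ (d - k)).
Proof.
move=> kd; rewrite init_targetE // -{1}[U k]entryK trmx_mxf mulmx_mxf.
apply: eq_mxf => s b hs hb.
rewrite (big_ord_mul p (r k.-1) (fun y => entry (U k) y s *
  projected p r (left_cores U) (flat X) k y b)).
case: k kd hs hb => // k /andP[_ kd] hs hb; rewrite expnS.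
rewrite (big_ord_mul p (p ^ k) (fun a => lpart p r (left_cores U) k.+1 a s *
  flat X (a + p * p ^ k * b)%N)) /=.
apply: eq_bigr => x _.
under eq_bigr do rewrite /projected /= mulr_sumr.
rewrite exchange_big /=; apply: eq_bigr => a _.
rewrite modn_Madd // divn_Madd // mulr_suml; apply: eq_bigr => t _.
rewrite modn_Madd // divn_Madd // mulrCA mulrA /left_cores /=.
by rewrite expnS [(x * p ^ k)%N]mulnC [(_ + a)%N]addnC.
Qed.

Lemma reshape_projected (X : tensor R p d) U k : (0 < r k)%N -> (k < d)%N ->
  Defs.reshape (p * r k) (p ^ (d - k.+1)) (mxf (r k) (p ^ (d - k)) (fun s b =>
    \sum_(a < p ^ k) lpart p r (left_cores U) k a s * flat X (a + p ^ k * b)%N)) =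
  mxf (p * r k) (p ^ (d - k.+1)) (projected p r (left_cores U) (flat X) k.+1)
  :> 'M[R]_(_, _).
Proof.
move=> rk kd; rewrite reshape_mxf; last first.
  have -> : (d - k)%N = (d - k.+1).+1 by lia.
  by rewrite expnS mulnA [(r k * p)%N]mulnC.
apply: eq_mxf => y c hy hc; apply: eq_bigr => a _ /=.
have e : (y + p * r k * c = (y %/ r k + p * c) * r k + y %% r k)%N.
  rewrite {1}(divn_eq y (r k)); nia.
rewrite e modn_Madd ?ltn_mod // divn_Madd ?ltn_mod //.
by rewrite expnS mulnDr mulnA [(p ^ k * p)%N]mulnC addnA.
Qed.

Lemma residE (X : tensor R p d) U k : (forall j, (1 <= j < d)%N -> (0 < r j)%N) ->
  (1 <= k < d)%N -> resid X U k = init_target X U k.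
Proof.
move=> rpos; case: k => // k /andP[_]; elim: k => // k ih kd.
rewrite [LHS]/= -/(resid X U k.+1) ih; last by lia.
rewrite factor_init_target; last by lia.
by rewrite reshape_projected ?init_targetE //; [apply: rpos; lia | lia].
Qed.

End Residuals.

(** * Aggregatable transition tensors have low tensor-train rank *)

Section LowRank.
Variables (R : realType) (p d : nat) (r : nat -> nat) (P : tensor R p d).
Hypotheses (p0 : (0 < p)%N) (d2 : (2 <= d)%N).

Let digit (m t : nat) : 'I_p := Ordinal (ltn_pmod (m %/ p ^ t) p0).

Lemma eq_aggregate (G1 : 'I_p -> 'cV[R]_(r 1%N))
    (G : forall k, 'I_p -> 'cV[R]_(r k) -> 'cV[R]_(r k.+1)) i j k :
  (forall t, (t < k)%N -> i t = j t) ->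
  aggregate G1 G i k = aggregate G1 G j k.
Proof.
elim: k => //= k ih h; rewrite ih => [|t tk]; last by apply: h; lia.
by case: k ih h => [|k] ih h; rewrite h.
Qed.

(** [Phi] is the composition of the maps of the last [d - k] steps. *)
Lemma aggregate_tail (G : forall k, 'I_p -> 'cV[R]_(r k) -> 'cV[R]_(r k.+1))
    (Gd : 'I_p -> 'cV[R]_(r d.-1) -> R) (G1 : 'I_p -> 'cV[R]_(r 1%N)) k :
  (forall k x, (1 <= k < d.-1)%N -> linear (G k x)) ->
  (forall x, scalar (Gd x)) -> (1 <= k < d)%N ->
  exists Phi : (nat -> 'I_p) -> 'cV[R]_(r k) -> R,
    [/\ forall i, scalar (Phi i),
        forall i j, (forall t, (k <= t < d)%N -> i t = j t) -> Phi i = Phi j &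
        forall i, Gd (i d.-1) (aggregate G1 G i d.-1) =
                  Phi i (aggregate G1 G i k)].
Proof.
move=> linG linGd; move: k.
suff h n k : (n + k)%N = d.-1 -> (1 <= k)%N ->
  exists Phi : (nat -> 'I_p) -> 'cV[R]_(r k) -> R,
    [/\ forall i, scalar (Phi i),
        forall i j, (forall t, (k <= t < d)%N -> i t = j t) -> Phi i = Phi j &
        forall i, Gd (i d.-1) (aggregate G1 G i d.-1) =
                  Phi i (aggregate G1 G i k)].
  by move=> k /andP[k1 kd]; apply: (h (d.-1 - k)%N) => //; lia.
elim: n k => [|n ih] k nk k1.
  move: nk k1; rewrite add0n => ->; exists (fun i => Gd (i d.-1)); split=> //.
  by move=> i j h; rewrite h //; lia.
have aggS i : aggregate G1 G i k.+1 = G k (i k) (aggregate G1 G i k).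
  by case: (k) k1.
have [||Phi [lin loc eq]] := ih k.+1; [lia|by []|].
exists (fun i v => Phi i (G k (i k) v)); split.
- by move=> i a u v; rewrite linG ?lin //; lia.
- move=> i j h; rewrite (loc i j) => [|t tk]; last by apply: h; lia.
  by rewrite h //; lia.
- by move=> i; rewrite eq aggS.
Qed.

(** As the later maps are linear, the unfolding is a product of matrices: the
    aggregates of the first [k] states, which are vectors of length [r k], times
    the coefficients of the functionals of [aggregate_tail]. *)
Lemma aggregatable_rank k : state_aggregatable r P -> (1 <= k < d)%N ->
  (\rank (unfold k P) <= r k)%N.
Proof.
move=> [G1 [G [Gd [linG linGd eP]]]] kd.
have [Phi [lin loc eq]] := aggregate_tail G1 linG linGd kd.
pose A := mxf (p ^ k) (r k) (fun a s =>
  entry (aggregate G1 G (digit a) k) s 0%N).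
pose B : 'M[R]_(r k, p ^ (d - k)) :=
  \matrix_(s, b) Phi (digit (p ^ k * b)%N) (delta_mx s 0).
suff -> : unfold k P = A *m B.
  by apply: leq_trans (mxrankM_maxl _ _) (rank_leq_col _).
rewrite unfoldE //; last by lia.
apply/matrixP => a b; rewrite !mxE.
have hm : (a + p ^ k * b < p ^ d)%N.
  have -> : (p ^ d = p ^ k * p ^ (d - k))%N by rewrite -expnD subnKC //; lia.
  by have := ltn_ord a; have := ltn_ord b; nia.
rewrite (flatE p0 P (fun t => ltn_pmod ((a + p ^ k * b) %/ p ^ t)%N p0) hm).
rewrite (eP (digit (a + p ^ k * b)%N)) eq.
have -> : aggregate G1 G (digit (a + p ^ k * b)%N) k = aggregate G1 G (digit a) k.
  apply: eq_aggregate => t tk; apply/val_inj => /=.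
  have -> : (p ^ k * b = p * p ^ (k - t.+1) * b * p ^ t)%N.
    have -> : (p ^ k = p ^ t.+1 * p ^ (k - t.+1))%N by rewrite -expnD subnKC.
    by rewrite expnS; lia.
  rewrite addnC divnMDl ?expn_gt0 ?p0 //.
  by rewrite -mulnA mulnC modnMDl.
have -> : Phi (digit (a + p ^ k * b)%N) = Phi (digit (p ^ k * b)%N).
  apply: loc => t tk; apply/val_inj => /=; congr (_ %% _)%N.
  have -> : (p ^ t = p ^ k * p ^ (t - k))%N.
    by rewrite -expnD subnKC //; lia.
  by rewrite !divnMA divn_addM // mulnC mulnK // expn_gt0 p0.
set v := aggregate _ _ _ _; set Ph := Phi _.
have hPh : scalar Ph := lin _.
have PhD u w : Ph (u + w) = Ph u + Ph w by rewrite -[u]scale1r hPh scale1r mul1r.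
have Ph0 : Ph 0 = 0 by apply: (addIr (Ph 0)); rewrite -PhD !add0r.
have PhZ c u : Ph (c *: u) = c * Ph u by rewrite -[c *: u]addr0 hPh Ph0 addr0.
rewrite [v]matrix_sum_delta.
under eq_bigr => s _ do rewrite big_ord1.
rewrite (big_morph Ph PhD Ph0); apply: eq_bigr => s _.
by rewrite PhZ !mxE -(entryE v s ord0).
Qed.

End LowRank.

(** * Deterministic error bound for one iteration *)

Section Deterministic.
Variables (R : realType) (p d : nat) (r : nat -> nat).
Variables (Y P P1 : tensor R p d) (U Ut : left_family R p r).
Variables (V : right_family R p r) (c0 : R).
Hypotheses (p0 : (0 < p)%N) (d2 : (2 <= d)%N).
Hypotheses (r0 : r 0%N = 1%N) (rd : r d = 1%N).
Hypothesis rpos : forall k, (1 <= k < d)%N -> (0 < r k)%N.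
Hypothesis hc0 : 0 < c0 < 1.
Hypothesis ttoi : one_step_TTOI Y U V P1.
Hypothesis init : init_condition c0 P U Ut.
Hypothesis rankP : forall k, (1 <= k < d)%N -> (\rank (unfold k P) <= r k)%N.

Let L k := mxf (p ^ k) (r k) (lpart p r (left_cores U) k).
Let Q m k := mxf (p ^ m) (r k.-1) (rpart p r (right_cores V) m k).
Let X (x : nat -> R) k n := mxf (p ^ k) n (fun a y => x (a + p ^ k * y)%N).
Let kappa := (1 - c0 ^+ 2)^-1.

Let kappa_ge1 : 1 <= kappa.
Proof.
have /andP[h0 h1] := hc0.
by rewrite /kappa invf_ge1 //; nra.
Qed.

Let unfold_X (T : tensor R p d) k n : (k <= d)%N -> n = (p ^ (d - k))%N ->
  X (flat T) k n = conform_mx 0 (unfold k T).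
Proof. by move=> kd ->; rewrite conform_mx_id unfoldE. Qed.

Let rank_X k n : (1 <= k < d)%N -> n = (p ^ (d - k))%N ->
  (\rank (X (flat P) k n) <= r k)%N.
Proof.
move=> kd ->; rewrite unfold_X //; last by lia.
by rewrite conform_mx_id rankP.
Qed.

Let U_orth k : (1 <= k < d)%N -> (U k)^T *m U k = 1%:M.
Proof. by case: ttoi => + _ _ _ kd => /(_ k kd) /is_svdL_orthonormal. Qed.

Let L_orth k : (k < d)%N -> (L k)^T *m L k = 1%:M.
Proof. by move=> kd; apply: lpart_orthonormal => // j hj; apply: U_orth; lia. Qed.

Let L0_orth : L 0 *m (L 0)^T = 1%:M.
Proof.
apply/matrixP => i j; rewrite !mxE.
under eq_bigr do rewrite !mxE mulr1.
rewrite (sum_ord1 (fun=> 1) r0); case: eqVneq => //.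
by case: i j => [[|i] hi] [[|j] hj] //; rewrite -val_eqE.
Qed.

Let projected_L (T : tensor R p d) k n : n = (p ^ (d - k))%N ->
  mxf (r k) n (fun s b => \sum_(a < p ^ k)
    lpart p r (left_cores U) k a s * flat T (a + p ^ k * b)%N) =
  (L k)^T *m X (flat T) k n.
Proof. by move=> _; rewrite trmx_mxf mulmx_mxf. Qed.

(** The closeness of the estimated and the target singular space makes [U^T]
    almost isometric on the columns of the target matrix. *)
Lemma init_target_lower_bound k N (M : 'M[R]_(_, N)) : (1 <= k < d)%N ->
  fnorm2 (init_target P U k *m M) <=
  kappa * fnorm2 ((U k)^T *m init_target P U k *m M).
Proof.
move=> kd; have [svd sT] := init kd.
have /andP[h0 h1] := hc0.
have hk : 0 < 1 - c0 ^+ 2 by nra.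
have rA : (\rank (init_target P U k) <= r k)%N.
  rewrite /init_target; case: eqVneq => [k1|_].
    move: (rankP kd); rewrite k1 rank_recast //.
    by rewrite /= r0 muln1 expn1.
  apply: leq_trans (mxrankM_maxr _ _) _; rewrite rank_recast ?rankP //.
  by rewrite -expnS prednK //; case/andP: kd.
rewrite /kappa -ler_pdivrMl ?invr_gt0 // invrK.
set W := (Ut k)^T *m (init_target P U k *m M).
have eW : Ut k *m W = init_target P U k *m M.
  by rewrite /W [(Ut k)^T *m _]mulmxA mulmxA is_svdL_low_rank.
have := sinTheta_lower_bound W (rpos kd) hc0 sT.
by rewrite -(fnorm2_isoL W (is_svdL_orthonormal svd)) -mulmxA eW -!mulmxA.
Qed.

(** Moving one mode at a time from the columns to the rows turns the unfolding,
    projected by the factors found so far, into the next target matrix. *)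
Lemma left_projection_lower_bound k N n (M : 'M[R]_(n, N)) :
  (k < d)%N -> n = (p ^ (d - k))%N ->
  fnorm2 (X (flat P) k n *m M) <=
  kappa ^+ k * fnorm2 ((L k)^T *m X (flat P) k n *m M).
Proof.
elim: k N n M => [|k ih] N n M kd e.
  by rewrite expr0 mul1r -mulmxA (@fnorm2_isoL _ _ _ _ (L 0)^T) // trmxK L0_orth.
have en : (n * p = p ^ (d - k))%N by rewrite e -expnSr; congr (_ ^ _)%N; lia.
have step1 : fnorm2 (X (flat P) k.+1 n *m M) =
    fnorm2 (X (flat P) k (n * p) *m (M *t (1%:M : 'M[R]_p))).
  rewrite fnorm2_mul_tens1 // -expnS; congr fnorm2; congr (_ *m _).
  apply: eq_mxf => y b _ _; congr flat.
  by rewrite {1}(divn_eq y (p ^ k)) expnS; lia.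
have step2 : fnorm2 ((L k)^T *m X (flat P) k (n * p) *m (M *t (1%:M : 'M[R]_p))) =
    fnorm2 (mxf (p * r k) n (projected p r (left_cores U) (flat P) k.+1) *m M).
  rewrite -projected_L // fnorm2_mul_tens1 //; congr fnorm2; congr (_ *m _).
  apply: eq_mxf => y b _ _; apply: eq_bigr => a _ /=; congr (_ * flat _ _).
  by rewrite expnS; lia.
rewrite step1; apply: le_trans (ih _ _ _ _ en) _; first by lia.
rewrite step2 exprSr -mulrA ler_wpM2l ?exprn_ge0 //; first by have := kappa_ge1; lra.
rewrite -projected_L //; move: M {step1 step2 en}; rewrite e => M.
have kd' : (1 <= k.+1 < d)%N by [].
rewrite -(init_targetE p0 r0 P U kd') -(factor_init_target p0 r0 P U kd').
exact: (init_target_lower_bound M kd').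
Qed.


Let V_svd k m : (k.+1 + m)%N = d -> (1 <= k)%N ->
  is_svdR ((L k)^T *m X (flat Y) k (p ^ m * p) *m
           (Q m k.+2 *t (1%:M : 'M[R]_p))) (V k.+1).
Proof.
have [_ svd_d svd_k _] := ttoi.
move=> ed k1; rewrite -projected_L; last first.
  by rewrite -expnSr; congr (_ ^ _)%N; lia.
have tresidE j : (1 <= j < d)%N -> tresid Y U j = mxf (r j) (p ^ (d - j))
    (fun s b => \sum_(a < p ^ j) lpart p r (left_cores U) j a s *
       flat Y (a + p ^ j * b)%N) :> 'M[R]_(_, _).
  by move=> hj; rewrite /tresid (residE p0 r0) // (factor_init_target p0 r0).
case: m ed => [|m] ed.
  have {ed} ed : d = k.+1 by lia.
  move: svd_d; rewrite tresidE; last by lia.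
  have -> : Q 0 k.+2 *t (1%:M : 'M[R]_p) =
      mxf (p ^ 0 * p) (r k.+1 * p) (fun i j => (i == j)%:R).
    rewrite scalar_mxf tens_mxf; apply: eq_mxf => i j hi hj.
    rewrite /= in hj; rewrite expn0 mul1n in hi; rewrite -ed rd mul1n in hj.
    by rewrite /= mul1r !modn_small.
  move: (flat Y) rd => y; rewrite ed => rk; rewrite recast_mxf //; last first.
    by rewrite subSnn rk mul1n expn1.
  rewrite mulmx_mxf; congr is_svdR; apply: eq_mxf => s b hs hb.
  have hb' : (b < p ^ 0 * p)%N by move: hb; rewrite rk.
  rewrite /= -(sum_delta (fun i => \sum_(a < p ^ k)
    lpart p r (left_cores U) k a s * y (a + p ^ k * i)%N) hb').
  by apply: eq_bigr => i _; rewrite mulrC eq_sym.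
have hk : (2 <= k.+1 < d)%N by lia.
have := svd_k _ hk; rewrite tresidE; last by lia.
rewrite /prodR (prodR_recE p0 rd); last by lia.
rewrite scalar_mxf tens_mxf recast_mxf //; last first.
  by rewrite -expnSr; congr (_ ^ _)%N; lia.
rewrite [Q _ _ *t _]tens_mxf.
rewrite (_ : (d - k.+1.-1 = m.+2)%N); last by lia.
by rewrite expnSr (_ : ((d - k.+2).+1 = m.+1)%N); last by lia.
Qed.

Let V_orth k : (1 < k <= d)%N -> (V k)^T *m V k = 1%:M.
Proof.
case: k => // k kd; have [m em] : exists m, (k.+1 + m)%N = d.
  by exists (d - k.+1)%N; lia.
by apply/is_svdR_orthonormal/(V_svd em); lia.
Qed.

Let Q_orth m k : (k + m = d.+1)%N -> (1 < k)%N -> (Q m k)^T *m Q m k = 1%:M.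
Proof.
by move=> ed k1; apply: (rpart_orthonormal p0 rd ed) => [|j hj];
  [lia|apply: V_orth; lia].
Qed.

Let G_orth m k : (k + m = d.+1)%N -> (1 < k)%N ->
  (Q m k *t (1%:M : 'M[R]_p))^T *m (Q m k *t (1%:M : 'M[R]_p)) = 1%:M.
Proof. by move=> *; rewrite trmx_tens tensmx_mul trmx1 mul1mx Q_orth // tens1. Qed.


(** All the randomness enters through [e], a bound for the pairing of the noise
    with normalized tensor trains. A factor with orthonormal columns has squared
    norm equal to its number of columns, hence the bound [rmax] on the cores. *)
Variables (rmax e : R).
Let z m := flat Y m - flat P m.
Hypothesis r_le : forall k, (k <= d)%N -> (r k)%:R <= rmax.
Hypothesis e_ge0 : 0 <= e.
Hypothesis noise : forall A : cores R,
  (forall k, (1 <= k <= d)%N -> \sum_(x < p) \sum_(s < r k.-1) \sum_(t < r k)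
     A k x s t ^+ 2 <= rmax) ->
  \sum_(m < p ^ d) lpart p r A d m 0 ^+ 2 <= 1 ->
  \sum_(m < p ^ d) z m * lpart p r A d m 0 <= e.

Let left_core_norm k : (1 <= k < d)%N ->
  \sum_(x < p) \sum_(s < r k.-1) \sum_(t < r k) left_cores U k x s t ^+ 2 =
  (r k)%:R.
Proof.
move=> kd; rewrite -[RHS]mxtrace1 -(U_orth kd) -fnorm2_tr -[U k]entryK.
rewrite fnorm2_mxf (big_ord_mul p (r k.-1)
  (fun y => \sum_(t < r k) entry (U k) y t ^+ 2)).
by [].
Qed.

Let right_core_norm k : (1 < k <= d)%N ->
  \sum_(x < p) \sum_(s < r k.-1) \sum_(t < r k) right_cores V k x s t ^+ 2 =
  (r k.-1)%:R.
Proof.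
move=> kd; rewrite -[RHS]mxtrace1 -(V_orth kd) -fnorm2_tr -[V k]entryK.
rewrite fnorm2_mxf (big_ord_mul (r k) p
  (fun y => \sum_(s < r k.-1) entry (V k) y s ^+ 2)).
rewrite [RHS]exchange_big /=; apply: eq_bigr => x _.
by rewrite exchange_big.
Qed.

(** Compressing the noise by the factors on both sides of one mode leaves a
    core [E]; putting [E] back between these factors gives a tensor train of
    norm [|E|], whose pairing with the noise is [|E|^2]. *)
Lemma compressed_noise k m : (k.+1 + m)%N = d ->
  fnorm2 ((L k)^T *m X z k (p ^ m * p) *m (Q m k.+2 *t (1%:M : 'M[R]_p)))
    <= e ^+ 2.
Proof.
move=> ed; set G := Q m k.+2 *t _; set E := _ *m G.
have hG : G^T *m G = 1%:M by apply: G_orth; lia.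
have hL := @L_orth k ltac:(lia).
have [E0|En0] := eqVneq (fnorm2 E) 0; first by rewrite E0 sqr_ge0.
have Ep : 0 < fnorm2 E by rewrite lt_def En0 fnorm2_ge0.
pose f := Num.sqrt (fnorm2 E).
have fp : 0 < f by rewrite sqrtr_gt0.
have ff : f ^+ 2 = fnorm2 E by rewrite sqr_sqrtr // ltW.
pose A : cores R := fun j x s t =>
  if (j <= k)%N then left_cores U j x s t else
  if j == k.+1 then entry E s (t * p + x) / f else right_cores V j x s t.
have lpartA a y : (a < p ^ k)%N -> (y < p ^ m * p)%N ->
    lpart p r A d (a + p ^ k * y)%N 0 = entry (L k *m E *m G^T) a y / f.
  move=> ha hy; rewrite (lpart_cut p0 A rd (m := m.+1) (k := k)) ?expnSr //;
    last by lia.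
  have -> : L k *m E *m G^T = mxf (p ^ k) (p ^ m * p) (fun a y =>
      \sum_(q < r k.+1 * p) (\sum_(s < r k)
        lpart p r (left_cores U) k a s * entry E s q) *
        (rpart p r (right_cores V) m k.+2 (y %/ p)%N (q %/ p)%N *
         (y %% p == q %% p)%N%:R)).
    by rewrite /G -{1}[E]entryK scalar_mxf tens_mxf trmx_mxf !mulmx_mxf.
  rewrite entry_mxf // (big_ord_mul (r k.+1) p (fun q =>
    (\sum_(s < r k) lpart p r (left_cores U) k a s * entry E s q) *
    (rpart p r (right_cores V) m k.+2 (y %/ p)%N (q %/ p)%N *
     (y %% p == q %% p)%N%:R))) mulr_suml.
  transitivity (\sum_(s < r k) \sum_(t < r k.+1)
      lpart p r (left_cores U) k a s *
      rpart p r (right_cores V) m k.+2 (y %/ p)%N t *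
      (entry E s (t * p + y %% p)%N / f)).
    apply: eq_bigr => s _; rewrite /= mulr_sumr; apply: eq_bigr => t _.
    rewrite mulrA; congr (_ * _ * _); last by rewrite /A ltnn eqxx.
    - apply: eq_lpart => // j x s' t' hj *; rewrite /A.
      by case/andP: hj => _ ->.
    - apply: eq_rpart => //; first by rewrite ltn_divLR.
      move=> j x s' t' hj *; rewrite /A.
      by rewrite ifN ?ifN //; lia.
  rewrite exchange_big /=; apply: eq_bigr => t _.
  transitivity ((\sum_(s < r k) lpart p r (left_cores U) k a s *
     entry E s (t * p + y %% p)%N) *
     rpart p r (right_cores V) m k.+2 (y %/ p)%N t / f).
    by rewrite !mulr_suml; apply: eq_bigr => s _; rewrite !mulrA; congr (_ / _);
       rewrite mulrAC.
  congr (_ / f); rewrite -(sum_delta (fun x => (\sum_(s < r k)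
     lpart p r (left_cores U) k a s * entry E s (t * p + x)%N) *
     rpart p r (right_cores V) m k.+2 (y %/ p)%N t) (ltn_pmod y p0)).
  apply: eq_bigr => x _; rewrite modn_Madd // divn_Madd //.
  by rewrite mulrC mulrA.
set T := L k *m E *m G^T in lpartA.
have nT : fnorm2 T = fnorm2 E by rewrite /T fnorm2_isoR // fnorm2_isoL.
have split_sum (F : nat -> R) : \sum_(q < p ^ d) F q =
    \sum_(a < p ^ k) \sum_(y < p ^ m * p) F (a + p ^ k * y)%N.
  have -> : (p ^ d = p ^ k * (p ^ m * p))%N.
    by rewrite -expnSr -expnD; congr (_ ^ _)%N; lia.
  exact: big_ord_mul_col.
have pairing : \sum_(q < p ^ d) z q * lpart p r A d q 0 = f.
  rewrite (split_sum (fun q => z q * lpart p r A d q 0)).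
  transitivity ((\sum_(a < p ^ k) \sum_(y < p ^ m * p)
      X z k (p ^ m * p) a y * T a y) / f).
    rewrite mulr_suml; apply: eq_bigr => a _; rewrite mulr_suml.
    by apply: eq_bigr => y _; rewrite lpartA // mxE entryE mulrA.
  rewrite -mxtrace_trmx_mul /T mulmxA mxtrace_mulC.
  have -> : G^T *m ((X z k (p ^ m * p))^T *m (L k *m E)) = E^T *m E.
    by rewrite {2}/E !trmx_mul trmxK !mulmxA.
  by rewrite -fnorm2_tr -ff expr2 mulfK // gt_eqF.
suff h : f <= e by rewrite -ff lerXn2r ?nnegrE // ltW.
rewrite -pairing; apply: noise.
  move=> j hj; rewrite /A; case: (leqP j k) => [jk|kj].
    by rewrite left_core_norm ?r_le //; lia.
  case: eqVneq => [->|jk].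
    rewrite /=; apply: (@le_trans _ _ 1); last first.
      apply: le_trans (r_le (leqnn d)); by rewrite rd.
    rewrite le_eqVlt; apply/orP; left; apply/eqP.
    transitivity (fnorm2 E / f ^+ 2); last by rewrite ff divff.
    rewrite -[E]entryK fnorm2_mxf mulr_suml [LHS]exchange_big /=.
    apply: eq_bigr => s _; rewrite (big_ord_mul (r k.+1) p
      (fun q => entry E s q ^+ 2)) mulr_suml [LHS]exchange_big /=.
    apply: eq_bigr => t _; rewrite mulr_suml; apply: eq_bigr => x _.
    by rewrite exprMn exprVn entryK.
  by rewrite right_core_norm ?r_le //; lia.
rewrite (split_sum (fun q => lpart p r A d q 0 ^+ 2)) le_eqVlt; apply/orP; left; apply/eqP.
transitivity (fnorm2 T / f ^+ 2); last by rewrite nT ff divff.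
rewrite /fnorm2 mulr_suml; apply: eq_bigr => a _; rewrite mulr_suml.
by apply: eq_bigr => y _; rewrite lpartA // entryE exprMn exprVn.
Qed.


Let X_noise k n : X (flat Y) k n = X (flat P) k n + X z k n.
Proof. by apply/matrixP => i j; rewrite !mxE /z addrC subrK. Qed.

Let kappa_le k : (k <= d)%N -> kappa ^+ k <= kappa ^+ d.
Proof. by move=> kd; apply: ler_weXn2l => //; apply: kappa_ge1. Qed.

Let kappa_ge0 k : 0 <= kappa ^+ k.
Proof. by apply: exprn_ge0; have := kappa_ge1; lra. Qed.

(** The rows of the transition tensor are nearly contained in the estimated
    right space: splitting off one factor at a time, the part lost at each
    factor is a low rank residual, controlled by the compressed noise. *)
Lemma right_space_residual m k : (k + m)%N = d -> (1 <= k)%N ->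
  fnorm2 (X (flat P) k (p ^ m) *m (1%:M - Q m k.+1 *m (Q m k.+1)^T)) <=
  8 * kappa ^+ d * e ^+ 2 * (2 ^+ m - 1).
Proof.
elim: m k => [|m ih] k ed k1.
  have -> : Q 0 k.+1 *m (Q 0 k.+1)^T = 1%:M.
    apply/matrixP => i j; rewrite !mxE; under eq_bigr do rewrite !mxE mulr1.
    have rk : r k = 1%N by rewrite -rd -ed addn0.
    rewrite (sum_ord1 (fun=> 1) rk); case: eqVneq => //.
    by case: i j => [[|i] hi] [[|j] hj] //; rewrite -val_eqE.
  by rewrite subrr mulmx0 expr0 subrr mulr0 fnorm2_tr mulmx0 mxtrace0.
have {}ed : (k.+1 + m)%N = d by rewrite -ed addSnnS.
have kd : (k < d)%N by lia.
rewrite /X /Q (expnSr p m) -(rpart_step p0).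
rewrite -/(X (flat P) k (p ^ m * p)) -/(Q m k.+2); set G := Q m k.+2 *t _.
have hG : G^T *m G = 1%:M by apply: G_orth; lia.
set W := 1%:M - V k.+1 *m (V k.+1)^T.
have -> : 1%:M - G *m V k.+1 *m (G *m V k.+1)^T =
    (1%:M - Q m k.+2 *m (Q m k.+2)^T) *t (1%:M : 'M[R]_p) + G *m W *m G^T.
  have -> : (1%:M - Q m k.+2 *m (Q m k.+2)^T) *t (1%:M : 'M[R]_p) =
      1%:M - G *m G^T.
    by rewrite tensmxBl tens1 /G trmx_tens tensmx_mul trmx1 mulmx1.
  by rewrite /W mulmxBr mulmx1 mulmxBl trmx_mul !mulmxA addrA subrK.
rewrite mulmxDr; apply: le_trans (fnorm2D _ _) _.
have h1 : fnorm2 (X (flat P) k (p ^ m * p) *m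
    ((1%:M - Q m k.+2 *m (Q m k.+2)^T) *t (1%:M : 'M[R]_p))) <=
    8 * kappa ^+ d * e ^+ 2 * (2 ^+ m - 1).
  rewrite fnorm2_mul_tens1 // -expnS; apply: le_trans (ih k.+1 ed _) => //.
  rewrite le_eqVlt; apply/orP; left; apply/eqP; congr fnorm2; congr (_ *m _).
  apply: eq_mxf => y b _ _; congr flat.
  by rewrite {3}(divn_eq y (p ^ k)) expnS; lia.
have h2 : fnorm2 (X (flat P) k (p ^ m * p) *m (G *m W *m G^T)) <=
    4 * kappa ^+ d * e ^+ 2.
  rewrite mulmxA fnorm2_isoR //.
  apply: le_trans (left_projection_lower_bound _ kd _) _.
    by rewrite -expnSr; congr (_ ^ _)%N; lia.
  rewrite mulmxA.
  apply: (@le_trans _ _ (kappa ^+ d * (4 * e ^+ 2))); last by rewrite !mulrA [4 * _]mulrC.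
  apply: ler_pM => //; [exact: fnorm2_ge0|exact/kappa_le/ltnW|].
  apply: le_trans (low_rank_residual (E := (L k)^T *m X z k (p ^ m * p) *m G) _ _) _.
  - by rewrite -mulmxDl -mulmxDr -X_noise; apply: V_svd.
  - apply: leq_trans (mxrankM_maxl _ _) _; apply: leq_trans (mxrankM_maxr _ _) _.
    by apply: rank_X; [lia|rewrite -expnSr; congr (_ ^ _)%N; lia].
  - by rewrite ler_wpM2l // compressed_noise.
rewrite [2 ^+ m.+1]exprS; move: h1 h2.
move: (kappa ^+ d) (2 ^+ m) (e ^+ 2) (fnorm2 _) (fnorm2 _) => K t f a b; lra.
Qed.

Let fnorm2_dist_X (S T : tensor R p d) k n : (k <= d)%N -> n = (p ^ (d - k))%N ->
  fnorm2_dist S T = fnorm2 (X (flat S) k n - X (flat T) k n).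
Proof.
move=> kd ->; rewrite fnorm2_distE //.
have -> : (p ^ d = p ^ k * p ^ (d - k))%N by rewrite -expnD subnKC.
rewrite (big_ord_mul_col (p ^ k) (p ^ (d - k))
  (fun m => (flat S m - flat T m) ^+ 2)).
by do 2!apply: eq_bigr => ? _; rewrite !mxE.
Qed.

(** The estimate is the projection of the noisy tensor onto the right space: its
    error consists of the projected noise, which is a compressed noise at the
    first mode, and of the part of the signal outside that space. *)
Theorem one_step_error :
  fnorm2_dist P1 P <= (2 + 16 * kappa ^+ d * 2 ^+ d) * e ^+ 2.
Proof.
have [_ _ _] := ttoi; set m := (d - 1)%N => eP1.
have em : (1 + m)%N = d by rewrite /m; lia.
have d1 : (1 <= d)%N by lia.
rewrite (@fnorm2_dist_X _ _ 1 (p ^ m)) //.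
have eW : recast (p ^ m) (r 1%N) (prodR d V 2) = Q m 2.
  rewrite /prodR (prodR_recE p0 rd) ?subnKC // recast_mxf //.
    by congr (mxf _ _ (rpart _ _ _ _ _)); lia.
  by congr (_ ^ _)%N; lia.
have -> : X (flat P1) 1 (p ^ m) - X (flat P) 1 (p ^ m) =
    X z 1 (p ^ m) *m Q m 2 *m (Q m 2)^T -
    X (flat P) 1 (p ^ m) *m (1%:M - Q m 2 *m (Q m 2)^T).
  move: eP1; rewrite /= -/m eW !unfoldE // -/m -!/(X _ 1 (p ^ m)) => ->.
  rewrite X_noise mulmxBr mulmx1 !mulmxDl !mulmxA opprB.
  by rewrite [RHS]addrCA addrA.
apply: le_trans (fnorm2B _ _) _.
have h1 : fnorm2 (X z 1 (p ^ m) *m Q m 2 *m (Q m 2)^T) <= e ^+ 2.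
  rewrite fnorm2_isoR; last by apply: Q_orth; lia.
  apply: le_trans (compressed_noise (k := 0) em).
  rewrite -mulmxA (@fnorm2_isoL _ _ _ _ (L 0)^T) ?trmxK ?L0_orth //.
  rewrite fnorm2_mul_tens1 // -expnS le_eqVlt; apply/orP; left; apply/eqP.
  congr fnorm2; congr (_ *m _); apply: eq_mxf => y b _ _.
  by congr z; rewrite expn0 modn1 divn1 mul1n add0n.
have := right_space_residual em (leqnn 1).
have he := sqr_ge0 e; have hk := kappa_ge0 d.
have hm : 2 ^+ m - 1 <= 2 ^+ d :> R.
  by have := @ler_weXn2l R 2 ltac:(lra) m d ltac:(lia); lra.
have : kappa ^+ d * e ^+ 2 * (2 ^+ m - 1) <= kappa ^+ d * e ^+ 2 * 2 ^+ d.
  by rewrite ler_wpM2l // mulr_ge0.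
move: h1 he hk hm.
move: (kappa ^+ d) (2 ^+ m) (2 ^+ d) (e ^+ 2) (fnorm2 _) (fnorm2 _) => *; lra.
Qed.

End Deterministic.

(** * Concentration in the sampling model *)

Section Fibers.
Variables (p d : nat).
Hypothesis d0 : (0 < d)%N.

Let last_coord : 'I_d := Ordinal (ltac:(by rewrite ltn_predL) : (d.-1 < d)%N).

Lemma front_snoc (c : midx p d.-1) x : front (snoc c x) = c.
Proof.
apply/ffunP => t; rewrite !ffunE /= (insubT (fun m => m < d.-1)%N (ltn_ord t)).
by congr (c _); apply/val_inj.
Qed.

Lemma snoc_last (c : midx p d.-1) x : snoc c x last_coord = x.
Proof. by rewrite ffunE insubN //= ltnn. Qed.

Lemma snoc_front (i : midx p d) : snoc (front i) (i last_coord) = i.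
Proof.
apply/ffunP => t; rewrite ffunE; case: insubP => [t' _ e|].
  by rewrite ffunE; congr (i _); apply/val_inj.
rewrite -leqNgt => h; congr (i _); apply/val_inj => /=.
by have := ltn_ord t; lia.
Qed.

Lemma sum_fibers (V : nmodType) (F : midx p d -> V) :
  \sum_i F i = \sum_(c : midx p d.-1) \sum_(x < p) F (snoc c x).
Proof.
rewrite pair_big /=.
rewrite (reindex (fun cx : midx p d.-1 * 'I_p => snoc cx.1 cx.2)) //=.
exists (fun i => (front i, i last_coord)) => [[c x]|i] _ /=.
  by rewrite front_snoc snoc_last.
exact: snoc_front.
Qed.

Lemma snoc_front_eq (i : midx p d) x :
  (snoc (front i) x == i) = (x == i last_coord).
Proof.
apply/eqP/eqP => [<-|->]; last exact: snoc_front.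
by rewrite snoc_last.
Qed.

Lemma snoc_inj (c : midx p d.-1) x x' :
  (snoc c x' == snoc c x) = (x' == x).
Proof. by have := snoc_front_eq (snoc c x) x'; rewrite front_snoc snoc_last. Qed.

End Fibers.

Section Simplex.
Variables (R : realType) (p d : nat).
Hypothesis d0 : (0 < d)%N.

(** The projection is at least as close to its input as the true transition
    probabilities are, since the latter lie in the simplex. *)
Lemma fiber_proj_error (P X1 X : tensor R p d) :
  transition_tensor P -> is_fiber_proj X1 X ->
  fnorm2_dist X P <= 4 * fnorm2_dist X1 P.
Proof.
move=> [P0 P1] proj; rewrite /fnorm2_dist !(sum_fibers d0) mulr_sumr.
apply: ler_sum => c _.
have [_ /(_ (fun x => P (snoc c x)))] := proj c.
move=> /(_ (conj (P1 c) (fun=> P0 _))).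
rewrite ler_sqrt; last by apply: sumr_ge0 => x _; apply: sqr_ge0.
have : \sum_(x < p) (X (snoc c x) - P (snoc c x)) ^+ 2 <=
    2 * \sum_(x < p) (X1 (snoc c x) - X (snoc c x)) ^+ 2 +
    2 * \sum_(x < p) (X1 (snoc c x) - P (snoc c x)) ^+ 2.
  rewrite !mulr_sumr -big_split /=; apply: ler_sum => x _.
  move: (X _) (X1 _) (P _) => u v w.
  by have := sqr_ge0 (v - u + (v - w)); nra.
lra.
Qed.

End Simplex.

Section MomentGenerating.
Variable R : realType.

(** For [x <= 1/2] this follows from [expR x <= 1 / (1 - x)]; beyond,
    [x <= 2 x^2]. *)
Lemma expR_le_linear_plus (x : R) : expR x <= x + expR (2 * x ^+ 2).
Proof.
have [h|h] := lerP x 2^-1.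
  have h1 : 0 < 1 - x by lra.
  have h2 : 1 - x <= expR (- x) by have := expR_ge1Dx (- x); lra.
  have h3 : 1 + 2 * x ^+ 2 <= expR (2 * x ^+ 2) := expR_ge1Dx _.
  suff : expR x <= 1 + x + 2 * x ^+ 2 by lra.
  apply: (@le_trans _ _ ((1 - x)^-1)).
    by rewrite -[x in expR x]opprK expRN lef_pV2 // posrE ?expR_gt0.
  rewrite -[leLHS]mul1r ler_pdivrMr //.
  have : 0 <= x ^+ 2 * (1 - 2 * x) by rewrite mulr_ge0 ?sqr_ge0 //; lra.
  nra.
have : expR x <= expR (2 * x ^+ 2) by rewrite ler_expR; nra.
lra.
Qed.

(** Centering cancels the linear term of [expR_le_linear_plus], and the squared
    deviation from the mean is at most [4 b]. *)
Lemma centered_mgf_le (T : finType) (q f : T -> R) (b : R) :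
  (forall x, 0 <= q x) -> \sum_x q x = 1 -> (forall x, f x ^+ 2 <= b) ->
  \sum_x q x * expR (f x - \sum_y q y * f y) <= expR (8 * b).
Proof.
move=> q0 q1 fb; set mu := (\sum_y q y * f y).
have mu2 : mu ^+ 2 <= b.
  have : 0 <= \sum_x q x * (f x - mu) ^+ 2.
    by apply: sumr_ge0 => x _; rewrite mulr_ge0 ?sqr_ge0.
  have -> : \sum_x q x * (f x - mu) ^+ 2 = \sum_x q x * f x ^+ 2 - mu ^+ 2.
    transitivity (\sum_x (q x * f x ^+ 2 - 2 * mu * (q x * f x) + mu ^+ 2 * q x)).
      by apply: eq_bigr => x _; ring.
    by rewrite big_split /= sumrB -!mulr_sumr -/mu q1; ring.
  have : \sum_x q x * f x ^+ 2 <= \sum_x q x * b.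
    by apply: ler_sum => x _; rewrite ler_wpM2l.
  by rewrite -mulr_suml q1 mul1r; lra.
apply: (@le_trans _ _ (\sum_x (q x * (f x - mu) + q x * expR (8 * b)))).
  apply: ler_sum => x _; rewrite -mulrDr ler_wpM2l //.
  apply: le_trans (expR_le_linear_plus _) _; rewrite lerD2l ler_expR.
  by have := fb x; have := sqr_ge0 (f x + mu); nra.
rewrite big_split /= -mulr_suml q1 mul1r.
under eq_bigr do rewrite mulrBr.
by rewrite sumrB -mulr_suml q1 mul1r subrr add0r.
Qed.

End MomentGenerating.

Section Sampling.
Variables (R : realType) (p d n : nat).
Hypotheses (d0 : (0 < d)%N) (n0 : (0 < n)%N).
Variable P : tensor R p d.
Hypothesis hP : transition_tensor P.

Definition outcome := {ffun midx p d.-1 * 'I_n -> 'I_p}.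

Definition outcome_weight (w : outcome) : R :=
  \prod_(ck : midx p d.-1 * 'I_n) P (snoc ck.1 (w ck)).

Definition outcome_tensor (w : outcome) : tensor R p d :=
  fun i => n%:R^-1 * \sum_(k < n) (snoc (front i) (w (front i, k)) == i)%:R.

Lemma outcome_weight_ge0 w : 0 <= outcome_weight w.
Proof. by apply: prodr_ge0 => ck _; apply: (proj1 hP). Qed.

Lemma sum_outcome_prod (g : midx p d.-1 * 'I_n -> 'I_p -> R) :
  \sum_w outcome_weight w * \prod_ck g ck (w ck) =
  \prod_ck \sum_x P (snoc ck.1 x) * g ck x.
Proof.
rewrite bigA_distr_bigA; apply: eq_bigr => w _.
by rewrite /outcome_weight -big_split.
Qed.

Lemma sum_outcome_weight : \sum_w outcome_weight w = 1.
Proof.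
transitivity (\sum_w outcome_weight w * \prod_(ck : midx p d.-1 * 'I_n) (1 : R)).
  by apply: eq_bigr => w _; rewrite big1 ?mulr1.
rewrite (sum_outcome_prod (fun _ _ => 1)) big1 // => ck _.
by under eq_bigr do rewrite mulr1; apply: (proj2 hP).
Qed.

Lemma noise_pairing (w : outcome) (T : tensor R p d) :
  n%:R * \sum_i (outcome_tensor w i - P i) * T i =
  \sum_(ck : midx p d.-1 * 'I_n) (T (snoc ck.1 (w ck)) -
     \sum_x P (snoc ck.1 x) * T (snoc ck.1 x)).
Proof.
have nn0 : n%:R != 0 :> R by rewrite pnatr_eq0 -lt0n.
rewrite (sum_fibers d0) mulr_sumr.
rewrite [RHS](eq_bigr (fun ck => T (snoc ck.1 (w (ck.1, ck.2))) -
     \sum_x P (snoc ck.1 x) * T (snoc ck.1 x))); last by case.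
rewrite -(pair_bigA _ (fun c k => T (snoc c (w (c, k))) -
     \sum_x P (snoc c x) * T (snoc c x))) /=.
apply: eq_bigr => c _; rewrite sumrB sumr_const card_ord.
under eq_bigr do rewrite mulrBl.
rewrite sumrB mulrBr -[in RHS]mulr_natl; congr (_ - _).
rewrite /outcome_tensor mulr_sumr.
transitivity (\sum_(x < p) \sum_(k < n) (w (c, k) == x)%:R * T (snoc c x)).
  apply: eq_bigr => x _; rewrite mulrA mulrA divff // mul1r mulr_suml.
  by apply: eq_bigr => k _; rewrite front_snoc (snoc_inj d0).
rewrite exchange_big /=; apply: eq_bigr => k _.
rewrite (bigD1 (w (c, k))) //= eqxx mul1r big1 ?addr0 // => x.
by rewrite eq_sym => /negbTE ->; rewrite mul0r.
Qed.

(** Markov's inequality for the exponential moment at [s = tau / 64]. At one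
    context the test values satisfy [T^2 <= |T_c|^2], so the logarithm of that
    moment, [8 s^2 n |T|^2 - s n tau <= 32 s^2 n - s n tau], is smallest there. *)
Lemma chernoff_pairing (T : tensor R p d) (tau : R) :
  0 <= tau -> \sum_i T i ^+ 2 <= 4 ->
  \sum_(w | tau < \sum_i (outcome_tensor w i - P i) * T i) outcome_weight w <=
  expR (- (n%:R * tau ^+ 2 / 128)).
Proof.
move=> tau0 T4; pose s : R := tau / 64.
pose g w := \sum_i (outcome_tensor w i - P i) * T i.
have s0 : 0 <= s by rewrite /s; lra.
apply: (@le_trans _ _ (\sum_w outcome_weight w * expR (s * (n%:R * (g w - tau))))).
  rewrite big_mkcond; apply: ler_sum => w _; case: ltrP => h; last first.
    by rewrite mulr_ge0 ?outcome_weight_ge0 ?expR_ge0.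
  rewrite -[leLHS]mulr1 ler_wpM2l ?outcome_weight_ge0 // -expR0 ler_expR.
  by rewrite !mulr_ge0 // subr_ge0 ltW.
have hexp w : expR (s * (n%:R * (g w - tau))) =
    expR (- (s * n%:R * tau)) * \prod_(ck : midx p d.-1 * 'I_n)
      expR (s * T (snoc ck.1 (w ck)) -
            \sum_x P (snoc ck.1 x) * (s * T (snoc ck.1 x))).
  rewrite -expR_sum -expRD; congr expR.
  rewrite mulrBr noise_pairing mulrBr addrC mulrA; congr (_ + _).
  rewrite mulr_sumr; apply: eq_bigr => ck _; rewrite mulrBr mulr_sumr.
  by congr (_ - _); apply: eq_bigr => x _; rewrite mulrCA.
under eq_bigr => w _ do rewrite hexp mulrCA.
rewrite -mulr_sumr (sum_outcome_prod (fun ck y => expR (s * T (snoc ck.1 y) -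
            \sum_x P (snoc ck.1 x) * (s * T (snoc ck.1 x))))).
apply: (@le_trans _ _ (expR (- (s * n%:R * tau)) *
    \prod_(ck : midx p d.-1 * 'I_n)
       expR (8 * (s ^+ 2 * \sum_x T (snoc ck.1 x) ^+ 2)))).
  rewrite ler_wpM2l ?expR_ge0 //; apply: ler_prod => ck _; apply/andP; split.
    by apply: sumr_ge0 => x _; rewrite mulr_ge0 ?expR_ge0 //; apply: (proj1 hP).
  apply: (centered_mgf_le (q := fun x => P (snoc ck.1 x))
           (f := fun x => s * T (snoc ck.1 x))).
  - by move=> x; apply: (proj1 hP).
  - exact: (proj2 hP).
  - move=> x; rewrite exprMn ler_wpM2l ?sqr_ge0 // (bigD1 x) //= lerDl.
    by apply: sumr_ge0 => y _; apply: sqr_ge0.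
rewrite -expR_sum -expRD ler_expR.
rewrite -(pair_bigA _ (fun c k => 8 * (s ^+ 2 * \sum_x T (snoc c x) ^+ 2))) /=.
under eq_bigr => c _ do rewrite sumr_const card_ord -[_ *+ n]mulr_natl.
rewrite -!mulr_sumr -(sum_fibers d0 (fun i => T i ^+ 2)).
have : n%:R * (8 * (s ^+ 2 * \sum_i T i ^+ 2)) <= n%:R * (8 * (s ^+ 2 * 4)) :> R.
  by rewrite !ler_wpM2l ?sqr_ge0 //.
rewrite /s; move: (n%:R) => N; set S := \sum_i _; nra.
Qed.

End Sampling.

Section Law.
Variables (R : realType) (p d n : nat) (P : tensor R p d).
Variables (disp : measure_display) (T : measurableType disp).
Variables (Pr : probability T R) (X : midx p d.-1 -> 'I_n -> T -> 'I_p).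
Hypothesis gen : generative_model Pr P X.

Definition observed (w : T) : outcome p d n := [ffun ck => X ck.1 ck.2 w].

Lemma empirical_observed w : empirical R X w = outcome_tensor R (observed w).
Proof.
apply/funext => i; rewrite /empirical /outcome_tensor; congr (_ * _).
by apply: eq_bigr => k _; rewrite ffunE.
Qed.

Let observed_cell (o : outcome p d n) :
  [set w | observed w = o] =
  [set w | forall ck, ck \in [set: midx p d.-1 * 'I_n]%SET ->
     X ck.1 ck.2 w \in [set o ck]%SET].
Proof.
apply/seteqP; split=> w /=.
  by move=> <- ck _; rewrite ffunE inE.
by move=> h; apply/ffunP => ck; rewrite ffunE; apply/set1P/h; rewrite inE.
Qed.

Let measurable_cell (o : outcome p d n) : measurable [set w | observed w = o].
Proof.
have -> : [set w | observed w = o] =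
    \bigcap_(ck in [set: midx p d.-1 * 'I_n]) [set w | X ck.1 ck.2 w = o ck].
  apply/seteqP; split=> w /=.
    by move=> <- ck _ /=; rewrite ffunE.
  by move=> h; apply/ffunP => ck; rewrite ffunE; apply: h.
apply: fin_bigcap_measurable; first exact: finite_finset.
by move=> ck _; case: gen.
Qed.

Let probability_cell (o : outcome p d n) :
  Pr [set w | observed w = o] = (outcome_weight P o)%:E.
Proof.
rewrite observed_cell; have [_ marg ->] := gen.
rewrite /outcome_weight -prodEFin; apply: eq_big => [ck|ck _].
  by rewrite inE.
rewrite -(marg ck.1 ck.2); congr (Pr _).
by apply/seteqP; split=> w /=; rewrite inE => /eqP.
Qed.

(** The event is a finite disjoint union of cells on which all observations are
    prescribed; independence makes the probability of a cell a product. *)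
Lemma probability_observed (E : pred (outcome p d n)) :
  Pr [set w | E (observed w)] = (\sum_(o | E o) outcome_weight P o)%:E.
Proof.
have cell_sum (s : seq (outcome p d n)) : uniq s ->
    measurable [set w | observed w \in s] /\
    Pr [set w | observed w \in s] = (\sum_(o <- s) outcome_weight P o)%:E.
  elim: s => [_|o s ih /andP[os us]].
    have -> : [set w | observed w \in [::]] = set0 by apply/seteqP; split.
    by rewrite big_nil measure0; split=> //; apply: measurable0.
  have [ms es] := ih us.
  have -> : [set w | observed w \in o :: s] =
      [set w | observed w = o] `|` [set w | observed w \in s].
    apply/seteqP; split=> w /=; rewrite inE.
      by move=> /orP[/eqP ->|]; [left|right].
    by case=> [->|->]; rewrite ?eqxx ?orbT.
  split; first exact: measurableU.
  rewrite measureU //; last first.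
    by apply/seteqP; split=> // w /= [->]; rewrite (negbTE os).
  by rewrite big_cons EFinD -probability_cell -es.
rewrite -big_enum /=; have [_ <-] := cell_sum (enum E) (enum_uniq _).
by congr (Pr _); apply/seteqP; split=> w /=; rewrite mem_enum.
Qed.

End Law.

(** * Rounding tensor trains to a finite grid *)

Section Affine.
Variable R : realType.

Definition affine (g : R -> R) := exists a b, forall t, g t = a + b * t.

Lemma affine_const (g : R -> R) c : (forall t, g t = c) -> affine g.
Proof. by move=> h; exists c, 0 => t; rewrite h mul0r addr0. Qed.

Lemma affine_mull c g : affine g -> affine (fun t => c * g t).
Proof.
by move=> [a [b h]]; exists (c * a), (c * b) => t; rewrite h mulrDr mulrA.
Qed.

Lemma affine_mulr c g : affine g -> affine (fun t => g t * c).
Proof.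
by move=> [a [b h]]; exists (a * c), (b * c) => t; rewrite h mulrDl mulrAC.
Qed.

Lemma affine_sum (I : Type) (s : seq I) (Q : pred I) (F : I -> R -> R) :
  (forall i, affine (F i)) -> affine (fun t => \sum_(i <- s | Q i) F i t).
Proof.
move=> h; elim: s => [|i s [a [b ih]]].
  by apply: (@affine_const _ 0) => t; rewrite big_nil.
have [a' [b' h']] := h i.
exists (if Q i then a' + a else a), (if Q i then b' + b else b) => t.
rewrite big_cons; case: (Q i); rewrite ih // h'; ring.
Qed.

Definition update (I : eqType) (x : I -> R) i t := fun j => if j == i then t else x j.

(** An affine function on an interval is largest at one of its ends, so one
    coordinate after the other may be moved to an end of its grid interval
    without loss. Contrary to rounding to the nearest point, this leaves no
    error in [f] to be absorbed. *)
Lemma round_multiaffine (I : finType) (f : (I -> R) -> R) (h : R) :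
  0 < h -> (forall x i, affine (fun t => f (update x i t))) ->
  forall x, exists z : I -> int,
    (forall i, `|x i - h * (z i)%:~R| <= h) /\
    f x <= f (fun i => h * (z i)%:~R).
Proof.
move=> h0 aff x.
have round1 y i : exists z : int, `|y i - h * z%:~R| <= h /\
    f y <= f (update y i (h * z%:~R)).
  have [a [b ab]] := aff y i.
  have fy : f y = a + b * y i.
    rewrite -ab; congr f; apply/funext => j; rewrite /update.
    by case: eqP => [->|].
  pose q := Num.floor (y i / h).
  have /andP[q1 q2] := Num.Theory.floor_itv (y i / h).
  rewrite -/q ler_pdivlMr // in q1; rewrite -/q ltr_pdivrMr // intrD in q2.
  have [b0|b0] := lerP 0 b.
    exists (q + 1); rewrite fy ab intrD; split; last by rewrite lerD2l ler_wpM2l //; lra.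
    by rewrite ler_norml; apply/andP; split; lra.
  exists q; rewrite fy ab; split; last by rewrite lerD2l ler_wnM2l //; lra.
  by rewrite ler_norml; apply/andP; split; lra.
have [y [ys yx fy]] : exists y : I -> R,
    [/\ forall i, i \in enum I -> exists z : int,
          y i = h * z%:~R /\ `|x i - h * z%:~R| <= h,
        forall i, i \notin enum I -> y i = x i & f x <= f y].
  elim: (enum I) => [|i s [y [ys yx fy]]]; first by exists x.
  have [is_|ins] := boolP (i \in s).
    exists y; split=> // j; rewrite inE; last by rewrite negb_or => /andP[_]; apply: yx.
    by case/orP => [/eqP ->|]; apply: ys.
  have [z [z1 z2]] := round1 y i.
  exists (update y i (h * z%:~R)); split; last exact: le_trans z2.
    move=> j; rewrite inE /update; case: eqP => [-> _|_ /=]; last exact: ys.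
    by exists z; rewrite -(yx _ ins).
  by move=> j; rewrite inE /update negb_or; case: eqP => //= _; apply: yx.
have /fin_all_exists[z hz] : forall i, exists z : int,
    y i = h * z%:~R /\ `|x i - h * z%:~R| <= h.
  by move=> i; apply: ys; rewrite mem_enum.
exists z; split=> [i|]; first by case: (hz i).
by rewrite (_ : (fun i => h * (z i)%:~R) = y) //; apply/funext => i; case: (hz i).
Qed.

End Affine.

Section CauchySchwarz.
Variable R : realType.

Lemma sum_Cauchy_Schwarz (I : finType) (a b : I -> R) :
  (\sum_i a i * b i) ^+ 2 <= (\sum_i a i ^+ 2) * (\sum_i b i ^+ 2).
Proof.
have : 0 <= \sum_i \sum_j (a i * b j - a j * b i) ^+ 2.
  by apply: sumr_ge0 => i _; apply: sumr_ge0 => j _; apply: sqr_ge0.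
have -> : \sum_i \sum_j (a i * b j - a j * b i) ^+ 2 =
   2 * ((\sum_i a i ^+ 2) * (\sum_i b i ^+ 2)) - 2 * (\sum_i a i * b i) ^+ 2.
  transitivity (\sum_i \sum_j (a i ^+ 2 * b j ^+ 2 + b i ^+ 2 * a j ^+ 2
      - 2 * ((a i * b i) * (a j * b j)))).
    by do 2!apply: eq_bigr => ? _; ring.
  under eq_bigr => i _ do rewrite sumrB big_split /= -!mulr_sumr.
  rewrite sumrB big_split /= -!mulr_suml -mulr_sumr -mulr_suml; ring.
lra.
Qed.

Variables (p : nat) (r : nat -> nat).
Hypothesis p0 : (0 < p)%N.

Let contraction_le m (q q' : nat) (L : nat -> nat -> R) (B : nat -> nat -> nat -> R) :
  \sum_(y < p * m) \sum_(c < q') (\sum_(s < q) L (y %% m)%N s * B (y %/ m)%N s c) ^+ 2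
  <= (\sum_(a < m) \sum_(s < q) L a s ^+ 2) *
     (\sum_(x < p) \sum_(s < q) \sum_(c < q') B x s c ^+ 2).
Proof.
rewrite (big_ord_mul p m (fun y => \sum_(c < q') (\sum_(s < q)
  L (y %% m)%N s * B (y %/ m)%N s c) ^+ 2)) mulr_sumr.
apply: ler_sum => x _; rewrite mulr_suml; apply: ler_sum => a _.
rewrite [X in _ * X]exchange_big mulr_sumr /=; apply: ler_sum => c _.
under eq_bigr => s _ do rewrite modn_Madd // divn_Madd //.
exact: sum_Cauchy_Schwarz.
Qed.

Definition core_norm2 (A : cores R) k : R :=
  \sum_(x < p) \sum_(s < r k.-1) \sum_(t < r k) A k x s t ^+ 2.

Lemma core_norm2_ge0 A k : 0 <= core_norm2 A k.
Proof. by do 3!(apply: sumr_ge0 => ? _); apply: sqr_ge0. Qed.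

Definition lpart_norm2 (A : cores R) k : R :=
  \sum_(a < p ^ k) \sum_(b < r k) lpart p r A k a b ^+ 2.

Hypothesis r0 : r 0%N = 1%N.

Let sum_scalar (F : nat -> nat -> R) :
  \sum_(a < p ^ 0) \sum_(b < r 0%N) F a b = F 0%N 0%N.
Proof. by rewrite r0 expn0 !big_ord1. Qed.

Lemma lpart_norm2_le A k Q : 0 <= Q ->
  (forall j, (1 <= j <= k)%N -> core_norm2 A j <= Q) ->
  lpart_norm2 A k <= Q ^+ k.
Proof.
move=> Q0; elim: k => [|k ih] hA.
  by rewrite /lpart_norm2 (sum_scalar (fun a b => lpart p r A 0 a b ^+ 2)) expr1n.
rewrite /lpart_norm2 expnS /=; apply: le_trans
  (contraction_le (p ^ k) (r k) (r k.+1) (lpart p r A k) (A k.+1)) _.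
rewrite exprSr; apply: ler_pM.
- by do 2!(apply: sumr_ge0 => ? _); apply: sqr_ge0.
- exact: (core_norm2_ge0 A k.+1).
- by apply: ih => j hj; apply: hA; lia.
- by apply: (hA k.+1); rewrite ltnS leqnn.
Qed.

(** The cores are replaced one after the other; by [(u + v)^2 <= 2 u^2 + 2 v^2],
    the factor 4 per core is 2 for the error made before and 2 for the new one. *)
Lemma lpart_perturbation A B k Q eta : 1 <= Q -> 0 <= eta ->
  (forall j, (1 <= j <= k)%N -> core_norm2 A j <= Q) ->
  (forall j, (1 <= j <= k)%N -> core_norm2 B j <= Q) ->
  (forall j, (1 <= j <= k)%N ->
     core_norm2 (fun i x s t => A i x s t - B i x s t) j <= eta) ->
  \sum_(a < p ^ k) \sum_(b < r k) (lpart p r A k a b - lpart p r B k a b) ^+ 2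
  <= eta * (4 * Q) ^+ k.
Proof.
move=> Q1 eta0; elim: k => [|k ih] hA hB hD.
  rewrite (sum_scalar (fun a b => (lpart p r A 0 a b - lpart p r B 0 a b) ^+ 2)).
  by rewrite /= subrr expr0n expr0 mulr1.
have hk : (1 <= k.+1 <= k.+1)%N by rewrite ltnS leqnn.
have hj j : (1 <= j <= k)%N -> (1 <= j <= k.+1)%N by lia.
have {}ih := ih (fun j h => hA j (hj j h)) (fun j h => hB j (hj j h))
  (fun j h => hD j (hj j h)).
pose D a s := lpart p r A k a s - lpart p r B k a s.
apply: (@le_trans _ _ (2 * (\sum_(y < p * p ^ k) \sum_(c < r k.+1)
    (\sum_(s < r k) D (y %% p ^ k)%N s * A k.+1 (y %/ p ^ k)%N s c) ^+ 2) +
  2 * (\sum_(y < p * p ^ k) \sum_(c < r k.+1)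
    (\sum_(s < r k) lpart p r B k (y %% p ^ k)%N s *
      (A k.+1 (y %/ p ^ k)%N s c - B k.+1 (y %/ p ^ k)%N s c)) ^+ 2))).
  rewrite expnS !mulr_sumr -big_split /=; apply: ler_sum => y _.
  rewrite !mulr_sumr -big_split /=; apply: ler_sum => c _.
  rewrite -sumrB.
  have -> : \sum_(s < r k) (lpart p r A k (y %% p ^ k)%N s * A k.+1 (y %/ p ^ k)%N s c
       - lpart p r B k (y %% p ^ k)%N s * B k.+1 (y %/ p ^ k)%N s c) =
      \sum_(s < r k) D (y %% p ^ k)%N s * A k.+1 (y %/ p ^ k)%N s c +
      \sum_(s < r k) lpart p r B k (y %% p ^ k)%N s *
       (A k.+1 (y %/ p ^ k)%N s c - B k.+1 (y %/ p ^ k)%N s c).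
    by rewrite -big_split; apply: eq_bigr => s _; rewrite /D /=; ring.
  have sq2 (u v : R) : (u + v) ^+ 2 <= 2 * u ^+ 2 + 2 * v ^+ 2.
    by have := sqr_ge0 (u - v); nra.
  exact: sq2.
have h1 := contraction_le (p ^ k) (r k) (r k.+1) D (A k.+1).
have h2 := contraction_le (p ^ k) (r k) (r k.+1) (lpart p r B k)
  (fun x s c => A k.+1 x s c - B k.+1 x s c).
have Q0 : 0 <= Q by lra.
have {}h1 := le_trans h1 (ler_pM _ (core_norm2_ge0 A k.+1) ih (hA _ hk)).
have {}h2 := le_trans h2 (ler_pM _ (core_norm2_ge0 _ k.+1)
  (lpart_norm2_le Q0 (fun j h => hB j (hj j h))) (hD _ hk)).
have {}h1 := h1 ltac:(by do 2!(apply: sumr_ge0 => ? _); apply: sqr_ge0).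
have {}h2 := h2 ltac:(by do 2!(apply: sumr_ge0 => ? _); apply: sqr_ge0).
have h3 : Q ^+ k * eta <= eta * (4 * Q) ^+ k * Q.
  rewrite mulrC -mulrA ler_wpM2l // -[leLHS]mulr1.
  apply: ler_pM => //; first exact: exprn_ge0.
  by apply: lerXn2r; rewrite ?nnegrE //; lra.
have -> : eta * (4 * Q) ^+ k.+1 = 4 * (eta * (4 * Q) ^+ k * Q).
  by rewrite exprSr; ring.
lra.
Qed.

End CauchySchwarz.

Section CoreParameters.
Variables (R : realType) (p d : nat) (r : nat -> nat).

(** One real parameter per core entry; the mode [tag i] of a parameter is
    0-based whereas cores are numbered from 1. *)
Definition core_index :=
  {k : 'I_d & 'I_p * ('I_(r k) * 'I_(r k.+1)) : finType}%type.

Definition index_at (k : 'I_d) (u : 'I_p * ('I_(r k) * 'I_(r k.+1))) :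
  core_index := existT _ k u.

Definition sits_at (i : core_index) (k y s t : nat) : bool :=
  [&& (tag i).+1 == k, (tagged i).1 == y :> nat,
      (tagged i).2.1 == s :> nat & (tagged i).2.2 == t :> nat].

Definition cores_of (x : core_index -> R) : cores R :=
  fun k y s t => \sum_(i | sits_at i k y s t) x i.

Implicit Types (x : core_index -> R) (i : core_index).

Lemma cores_ofE x (k : 'I_d) (u : 'I_p * ('I_(r k) * 'I_(r k.+1))) :
  cores_of x k.+1 u.1 u.2.1 u.2.2 = x (index_at u).
Proof.
rewrite /cores_of (big_pred1 (index_at u)) // => i.
apply/idP/eqP => [|->]; last by rewrite /sits_at !eqxx.
case: i => k' u' /and4P[/= /eqP[/val_inj e]]; subst k'.
case: u u' => [u1 [u2 u3]] [v1 [v2 v3]] /=.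
by move=> /eqP/val_inj -> /eqP/val_inj -> /eqP/val_inj ->.
Qed.

Lemma core_norm2_of x (k : 'I_d) : core_norm2 p r (cores_of x) k.+1 =
  \sum_(u : 'I_p * ('I_(r k) * 'I_(r k.+1))) x (index_at u) ^+ 2.
Proof.
rewrite (eq_bigr (fun u : 'I_p * ('I_(r k) * 'I_(r k.+1)) =>
   cores_of x k.+1 u.1 u.2.1 u.2.2 ^+ 2)); last by move=> u _; rewrite cores_ofE.
rewrite -(pair_bigA _ (fun (y : 'I_p) (v : 'I_(r k) * 'I_(r k.+1)) =>
  cores_of x k.+1 y v.1 v.2 ^+ 2)) /=.
apply: eq_bigr => y _.
by rewrite -(pair_bigA _ (fun (s : 'I_(r k)) (t : 'I_(r k.+1)) =>
  cores_of x k.+1 y s t ^+ 2)).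
Qed.

Lemma sum_core_norm2 x :
  \sum_i x i ^+ 2 = \sum_(k < d) core_norm2 p r (cores_of x) k.+1.
Proof.
under [RHS]eq_bigr do rewrite core_norm2_of.
rewrite (sig_big_dep xpredT (fun _ => xpredT)
  (fun (k : 'I_d) (u : 'I_p * ('I_(r k) * 'I_(r k.+1))) => x (index_at u) ^+ 2)).
by apply: eq_bigr => -[].
Qed.

Lemma card_core_index :
  #|{: core_index}| = (\sum_(1 <= i < d.+1) p * r i * r i.-1)%N.
Proof.
rewrite card_tagged sumnE big_map big_enum /= big_add1 /= big_mkord.
by apply: eq_bigr => k _; rewrite !card_prod !card_ord mulnA mulnAC.
Qed.

Lemma cores_ofB x y k m s t :
  cores_of x k m s t - cores_of y k m s t =
  cores_of (fun i => x i - y i) k m s t.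
Proof. by rewrite /cores_of sumrB. Qed.

Lemma cores_of_entries (A : cores R) k y s t :
  (1 <= k <= d)%N -> (y < p)%N -> (s < r k.-1)%N -> (t < r k)%N ->
  cores_of (fun i => A (tag i).+1 (tagged i).1 (tagged i).2.1 (tagged i).2.2)
    k y s t = A k y s t.
Proof.
case: k => // k kd hy hs ht.
by have := cores_ofE (fun i : core_index =>
   A (tag i).+1 (tagged i).1 (tagged i).2.1 (tagged i).2.2)
  (k := Ordinal kd) (Ordinal hy, (Ordinal hs, Ordinal ht)).
Qed.

Lemma affine_cores_of x i k y s t :
  affine (fun v => cores_of (update x i v) k y s t).
Proof.
apply: affine_sum => j; rewrite /update; case: eqP => _.
  by exists 0, 1 => v; rewrite add0r mul1r.
exact: (@affine_const _ _ (x j)).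
Qed.

Lemma cores_of_update x i v k y s t : k != (tag i).+1 ->
  cores_of (update x i v) k y s t = cores_of x k y s t.
Proof.
move=> ki; apply: eq_bigr => j /and4P[/eqP jk _ _ _].
by rewrite /update; case: eqP => // ji; rewrite -jk ji eqxx in ki.
Qed.

(** Each parameter occurs in a single core. *)
Lemma affine_lpart x i k a b :
  affine (fun v => lpart p r (cores_of (update x i v)) k a b).
Proof.
have const (j a' b' : nat) v : (j <= tag i)%N ->
    lpart p r (cores_of (update x i v)) j a' b' = lpart p r (cores_of x) j a' b'.
  elim: j a' b' => //= j ih a' b' hj; apply: eq_bigr => s _.
  by rewrite ih ?cores_of_update ?eqSS ?neq_ltn ?hj // ltnW.
elim: k a b => [|k ih] a b; first exact: (@affine_const _ _ 1).
apply: (@affine_sum R _ _ _ (fun (s : 'I_(r k)) v =>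
  lpart p r (cores_of (update x i v)) k (a %% p ^ k)%N s *
  cores_of (update x i v) k.+1 (a %/ p ^ k)%N s b)) => s.
have [ki|ki] := leqP k (tag i).
  have [c [e he]] := affine_mull (lpart p r (cores_of x) k (a %% p ^ k)%N s)
    (affine_cores_of x i k.+1 (a %/ p ^ k)%N s b).
  by exists c, e => v; rewrite const // he.
have [c [e he]] := affine_mulr (cores_of x k.+1 (a %/ p ^ k)%N s b)
  (ih (a %% p ^ k)%N s).
by exists c, e => v; rewrite cores_of_update ?he // eqSS neq_ltn ki orbT.
Qed.

End CoreParameters.

Section GridCount.
Variable R : realType.

(** Sign and magnitude; that zero is represented twice is harmless, as the grid
    only has to be counted from above. *)
Definition grid_value B (g : bool * 'I_B.+1) : R := (-1) ^+ g.1 * g.2%:R.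

Lemma sum_inv_squares B : \sum_(m < B.+1) (1 + (m%:R : R) ^+ 2)^-1 <= 3.
Proof.
suff : \sum_(m < B.+1) (1 + (m%:R : R) ^+ 2)^-1 <= 3 - 2 / B.+1%:R.
  by move=> h; apply: le_trans h _; rewrite lerBlDr lerDl divr_ge0.
elim: B => [|B ih]; first by rewrite big_ord1 /= expr0n /= addr0 invr1 mulr1; lra.
rewrite big_ord_recr /=; apply: le_trans (lerD ih (lexx _)) _.
have b0 : 0 <= B%:R :> R by [].
have e1 : 2 / B.+1%:R - 2 / B.+2%:R = 2 / (B.+1%:R * B.+2%:R) :> R.
  by rewrite -!natr1; field; apply/andP; split; rewrite gt_eqF //; lra.
suff : (1 + (B.+1%:R : R) ^+ 2)^-1 <= 2 / (B.+1%:R * B.+2%:R).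
  by rewrite -e1; move: (2 / B.+1%:R) (2 / B.+2%:R) (_^-1) => u v w; lra.
rewrite ler_pdivlMr; last by rewrite mulr_gt0.
rewrite mulrC ler_pdivrMr; last by have := sqr_ge0 (B.+1%:R : R); lra.
rewrite -!natr1; nra.
Qed.

(** Weigh the point [o] with [exp (N - |o|^2 / K)], where [N] is the dimension:
    this is at least 1 on the ball, and a product over the coordinates. *)
Lemma grid_ball_card (I : finType) B K : (0 < K)%N ->
  (\sum_(o : {ffun I -> bool * 'I_B.+1} |
     (\sum_i grid_value (o i) ^+ 2 <= #|I|%:R * K%:R :> R)%R) (1 : R)) <=
  (6 * expR 1 * K%:R) ^+ #|I|.
Proof.
move=> K0; have Kp : 0 < K%:R :> R by rewrite ltr0n.
pose W (g : bool * 'I_B.+1) : R := expR (1 - grid_value g ^+ 2 / K%:R).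
apply: (@le_trans _ _ (\sum_(o : {ffun I -> bool * 'I_B.+1}) \prod_i W (o i))).
  rewrite big_mkcond; apply: ler_sum => o _; case: ifP => h; last first.
    by apply: prodr_ge0 => i _; apply: expR_ge0.
  rewrite /W -expR_sum -[leLHS]expR0 ler_expR sumrB sumr_const -mulr_suml subr_ge0.
  by rewrite ler_pdivrMr.
rewrite -(bigA_distr_bigA (fun (_ : I) g => W g)) prodr_const.
apply: lerXn2r; rewrite ?nnegrE.
- by apply: sumr_ge0 => g _; apply: expR_ge0.
- by rewrite !mulr_ge0 ?expR_ge0.
apply: (@le_trans _ _ (\sum_(g : bool * 'I_B.+1)
    expR 1 * K%:R * (1 + (g.2%:R : R) ^+ 2)^-1)).
  apply: ler_sum => g _; rewrite /W expRD -mulrA ler_wpM2l ?expR_ge0 //.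
  have -> : grid_value g ^+ 2 = g.2%:R ^+ 2.
    by rewrite /grid_value exprMn sqrr_sign mul1r.
  set v := g.2%:R; have v0 : 0 <= v ^+ 2 := sqr_ge0 _.
  have K1 : 1 <= K%:R :> R by rewrite ler1n.
  have h1 : 1 + v ^+ 2 / K%:R <= expR (v ^+ 2 / K%:R) := expR_ge1Dx _.
  have h0 : 0 <= v ^+ 2 / K%:R by rewrite divr_ge0 // ltW.
  rewrite expRN; apply: (@le_trans _ _ ((1 + v ^+ 2 / K%:R)^-1)).
    by rewrite lef_pV2 // posrE; lra.
  rewrite -[K%:R in leRHS]invrK -invfM lef_pV2 ?posrE; [|lra|].
    rewrite mulrDr mulr1 mulrC lerD2r; first by rewrite invf_le1.
  by rewrite mulr_gt0 ?invr_gt0 //; lra.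
rewrite -mulr_sumr -(pair_bigA _ (fun (b : bool) (m : 'I_B.+1) =>
   (1 + (m%:R : R) ^+ 2)^-1)) /= big_bool /=.
rewrite -[6 * _ * _]mulrA [leRHS]mulrC ler_wpM2l ?mulr_ge0 ?expR_ge0 //.
have := sum_inv_squares B; move: (\sum_(m < _) _) => S; lra.
Qed.

End GridCount.

Section Net.
Variables (R : realType) (p d : nat) (r : nat -> nat) (rm : nat).
Hypotheses (p0 : (0 < p)%N) (r0 : r 0%N = 1%N) (rd : r d = 1%N).
Hypotheses (rm0 : (0 < rm)%N) (N0 : (0 < #|{: core_index p d r}|)%N).

Local Notation N := #|{: core_index p d r}|.

(** Trains with cores of squared norm at most [rm] are rounded to cores of
    squared norm at most [4 rm]; [net_mesh] makes the resulting perturbation of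
    the train at most 1, and [net_radius] bounds the mean square of the integer
    coordinates that occur. *)
Definition net_radius : nat := (d * (4 * rm) * (16 * rm) ^ d)%N.

Definition net_mesh : R := Num.sqrt (((16 * rm%:R) ^+ d)^-1 / N%:R).

Definition net_point (o : {ffun core_index p d r -> bool * 'I_(N * net_radius).+1})
  : core_index p d r -> R := fun i => net_mesh * grid_value R (o i).

Definition train (x : core_index p d r -> R) (m : nat) : R :=
  lpart p r (cores_of x) d m 0.

Definition net : pred {ffun core_index p d r -> bool * 'I_(N * net_radius).+1} :=
  fun o => (\sum_i grid_value R (o i) ^+ 2 <= N%:R * net_radius%:R) &&
           (\sum_(m < p ^ d) train (net_point o) m ^+ 2 <= 4).

(** The pairing with the noise is affine in each core entry, so the entries can
    be rounded without decreasing it. *)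
Lemma train_rounding (z : nat -> R) (A : cores R) :
  (forall k, (1 <= k <= d)%N -> core_norm2 p r A k <= rm%:R) ->
  \sum_(m < p ^ d) lpart p r A d m 0 ^+ 2 <= 1 ->
  exists2 o, net o & \sum_(m < p ^ d) z m * lpart p r A d m 0 <=
                     \sum_(m < p ^ d) z m * train (net_point o) m.
Proof.
move=> normA trainA.
have sq2 (u v : R) : v ^+ 2 <= 2 * u ^+ 2 + 2 * (u - v) ^+ 2.
  by rewrite -subr_ge0 (_ : _ - _ = (u - v + u) ^+ 2) ?sqr_ge0 //; ring.
pose x (i : core_index p d r) : R :=
  A (tag i).+1 (tagged i).1 (tagged i).2.1 (tagged i).2.2.
have trainx m : (m < p ^ d)%N -> lpart p r A d m 0 = train x m.
  move=> hm; apply: eq_lpart => //; first by rewrite rd.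
  by move=> j y s t *; rewrite cores_of_entries.
have normx k : (1 <= k <= d)%N -> core_norm2 p r (cores_of x) k <= rm%:R.
  move=> hk; apply: le_trans (normA k hk); rewrite le_eqVlt; apply/orP; left.
  by apply/eqP; do 3!(apply: eq_bigr => ? _); rewrite cores_of_entries.
have rm1 : 1 <= rm%:R :> R by rewrite ler1n.
have Np : 0 < N%:R :> R by rewrite ltr0n.
have D1 : 1 <= (16 * rm%:R) ^+ d :> R by rewrite exprn_ege1 //; lra.
have [eta etaE] : {eta : R | eta = ((16 * rm%:R) ^+ d)^-1} by eexists.
have eta0 : 0 < eta by rewrite etaE invr_gt0; lra.
have eta1 : eta <= 1 by rewrite etaE invf_le1 //; lra.
have h0 : 0 < net_mesh by rewrite /net_mesh -etaE sqrtr_gt0 divr_gt0.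
have h2 : net_mesh ^+ 2 = eta / N%:R.
  by rewrite /net_mesh -etaE sqr_sqrtr // ltW // divr_gt0.
have [||w [xw fw]] := @round_multiaffine _ _
  (fun y => \sum_(m < p ^ d) z m * train y m) net_mesh _ _ x.
- exact: h0.
- move=> y i; apply: affine_sum => m; apply: affine_mull.
  exact: affine_lpart.
set y := fun i => net_mesh * (w i)%:~R in fw.
have norm_diff k : (1 <= k <= d)%N ->
    core_norm2 p r (fun j u s t => cores_of x j u s t - cores_of y j u s t) k <= eta.
  case: k => // k hk.
  have -> : core_norm2 p r (fun j u s t => cores_of x j u s t - cores_of y j u s t) k.+1
      = core_norm2 p r (cores_of (fun i => x i - y i)) k.+1.
    by do 3!(apply: eq_bigr => ? _); rewrite cores_ofB.
  apply: (@le_trans _ _ (\sum_i (x i - y i) ^+ 2)).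
    rewrite (sum_core_norm2 (fun i => x i - y i)) (bigD1 (Ordinal hk)) //= lerDl.
    by apply: sumr_ge0 => j _; apply: core_norm2_ge0.
  apply: (@le_trans _ _ (\sum_(i : core_index p d r) net_mesh ^+ 2)).
    apply: ler_sum => i _; rewrite -real_normK ?num_real //.
    by apply: lerXn2r; rewrite ?nnegrE // ?(ltW h0) // xw.
  by rewrite sumr_const h2 -[_ *+ _]mulr_natr divfK // gt_eqF.
have normy k : (1 <= k <= d)%N -> core_norm2 p r (cores_of y) k <= 4 * rm%:R.
  move=> hk; apply: (@le_trans _ _ (2 * core_norm2 p r (cores_of x) k +
    2 * core_norm2 p r (fun j u s t => cores_of x j u s t - cores_of y j u s t) k)).
    rewrite /core_norm2 !mulr_sumr -big_split; apply: ler_sum => a _ /=.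
    rewrite !mulr_sumr -big_split; apply: ler_sum => b _ /=.
    rewrite !mulr_sumr -big_split; apply: ler_sum => c _ /=.
    exact: sq2.
  by have := normx k hk; have := norm_diff k hk; lra.
have trainy : \sum_(m < p ^ d) train y m ^+ 2 <= 4.
  have q1 : 1 <= 4 * rm%:R :> R by lra.
  have normx' k : (1 <= k <= d)%N -> core_norm2 p r (cores_of x) k <= 4 * rm%:R.
    by move=> hk; apply: le_trans (normx k hk) _; lra.
  have pert := lpart_perturbation p0 r0 q1 (ltW eta0) normx' normy norm_diff.
  have e4 : 4 * (4 * rm%:R) = 16 * rm%:R :> R by rewrite mulrA; congr (_ * _); lra.
  rewrite e4 {1}etaE mulVf ?gt_eqF // in pert; last by lra.
  have {}pert : \sum_(m < p ^ d) (train x m - train y m) ^+ 2 <= 1.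
    apply: le_trans pert; apply: ler_sum => m _.
    by rewrite (sum_ord1 (fun b => (lpart p r (cores_of x) d m b -
        lpart p r (cores_of y) d m b) ^+ 2) rd).
  have tx : \sum_(m < p ^ d) train x m ^+ 2 <= 1.
    apply: le_trans trainA; apply: ler_sum => m _; by rewrite trainx.
  apply: (@le_trans _ _ (2 * \sum_(m < p ^ d) train x m ^+ 2 +
      2 * \sum_(m < p ^ d) (train x m - train y m) ^+ 2)); last by lra.
  rewrite !mulr_sumr -big_split; apply: ler_sum => m _ /=.
  exact: sq2.
have w2 : \sum_i ((w i)%:~R : R) ^+ 2 <= N%:R * net_radius%:R.
  have : \sum_i y i ^+ 2 <= d%:R * (4 * rm%:R).
    rewrite sum_core_norm2 -[d in d%:R]card_ord mulr_natl -sumr_const.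
    by apply: ler_sum => k _; apply: normy; rewrite /= ltn_ord.
  have -> : \sum_i y i ^+ 2 = net_mesh ^+ 2 * \sum_i ((w i)%:~R : R) ^+ 2.
    by rewrite mulr_sumr; apply: eq_bigr => i _; rewrite exprMn.
  rewrite h2 /net_radius !natrM natrX natrM mulrAC ler_pdivrMr //.
  rewrite etaE mulrC ler_pdivrMr ?invr_gt0; last by lra.
  by move=> h; apply: le_trans h _; rewrite le_eqVlt; apply/orP; left; apply/eqP; ring.
have wE i : (w i)%:~R = (-1) ^+ (w i < 0)%R * (`|w i|%N)%:R :> R.
  by rewrite {1}[w i]intEsign rmorphM rmorphXn rmorphN1.
have wB i : (`|w i| <= N * net_radius)%N.
  rewrite -(ler_nat R) natrM; apply: le_trans w2.
  apply: (@le_trans _ _ (((w i)%:~R : R) ^+ 2)); last first.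
    by rewrite (bigD1 i) //= lerDl; apply: sumr_ge0 => j _; apply: sqr_ge0.
  rewrite wE exprMn sqrr_sign mul1r -natrX ler_nat.
  by case: (`|w i|%N) => // k; rewrite leq_pmulr.
pose o : {ffun core_index p d r -> bool * 'I_(N * net_radius).+1} :=
  [ffun i => (w i < 0, inord `|w i|)].
have oE i : grid_value R (o i) = (w i)%:~R.
  by rewrite /grid_value ffunE /= inordK ?ltnS // wE.
have oy : net_point o = y by apply/funext => i; rewrite /net_point oE.
exists o; last first.
  rewrite oy; apply: le_trans fw; rewrite le_eqVlt; apply/orP; left; apply/eqP.
  by apply: eq_bigr => m _; rewrite trainx.
rewrite /net oy trainy andbT.
by under eq_bigr do rewrite oE.
Qed.

End Net.

(** * Uniform concentration over the net, and the error bound *)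

Section UniformConcentration.
Variable R : realType.

(** Entropy of the net per parameter and per unit of [rm]. The count of
    [grid_ball_card] is the power [N] of [u * rm ^ (d + 1)] with
    [u = 24 e d 16^d], and [u <= exp u], [rm <= exp rm]. *)
Definition entropy_rate (d : nat) : R :=
  24 * expR 1 * d%:R * 16 ^+ d + d%:R + 1.

Lemma entropy_rate_ge0 d : 0 <= entropy_rate d.
Proof. by rewrite /entropy_rate !addr_ge0 ?mulr_ge0 ?expR_ge0 ?exprn_ge0. Qed.

Lemma net_entropy_le d rm N : (0 < rm)%N ->
  (6 * expR 1 * (net_radius d rm)%:R) ^+ N <=
  expR (entropy_rate d * rm%:R * N%:R) :> R.
Proof.
move=> rm0; rewrite expRM_natr; apply: lerXn2r; rewrite ?nnegrE ?mulr_ge0 ?expR_ge0 //.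
have expge (u : R) : u <= expR u by have := expR_ge1Dx u; lra.
have rm1 : 1 <= rm%:R :> R by rewrite ler1n.
pose u : R := 24 * expR 1 * d%:R * 16 ^+ d.
have u0 : 0 <= u by rewrite /u !mulr_ge0 ?expR_ge0 ?exprn_ge0.
have -> : 6 * expR 1 * (net_radius d rm)%:R = u * rm%:R ^+ d.+1 :> R.
  by rewrite /net_radius !natrM natrX natrM exprMn exprSr /u; ring.
apply: (@le_trans _ _ (expR u * expR rm%:R ^+ d.+1)).
  apply: ler_pM; [exact: u0|exact: exprn_ge0|exact: expge|].
  by apply: lerXn2r; rewrite ?nnegrE ?expR_ge0.
rewrite -expRM_natl -expRD ler_expR /entropy_rate -/u -natr1.
have : u <= u * rm%:R by rewrite ler_peMr.
move: (d%:R : R) => dd; nra.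
Qed.

Variables (p d n : nat) (r : nat -> nat) (rm : nat) (P : tensor R p d).
Hypotheses (p0 : (0 < p)%N) (d0 : (0 < d)%N) (n0 : (0 < n)%N) (rm0 : (0 < rm)%N).
Hypothesis hP : transition_tensor P.

Local Notation N := #|{: core_index p d r}|.

(** The level at which the tail of [chernoff_pairing] outweighs the entropy of
    the net by a factor [exp (rm N)]. *)
Definition noise_level : R :=
  Num.sqrt (128 * (entropy_rate d + 1) * rm%:R * (N%:R / n%:R)).

Lemma noise_level_sqr :
  noise_level ^+ 2 = 128 * (entropy_rate d + 1) * rm%:R * (N%:R / n%:R).
Proof.
by rewrite sqr_sqrtr // !mulr_ge0 ?invr_ge0 ?addr_ge0 // ?entropy_rate_ge0.
Qed.

Definition net_tensor o : tensor R p d :=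
  fun i => train (@net_point R p d r rm o) (flat_index i).

Definition large_noise (w : outcome p d n) : bool :=
  [exists o, @net R p d r rm o &&
    (noise_level < \sum_i (outcome_tensor R w i - P i) * net_tensor o i)].

(** Union bound: each tail is [exp (- (entropy_rate + 1) rm N)]. *)
Lemma large_noise_weight :
  \sum_(w | large_noise w) outcome_weight P w <= expR (- (rm%:R * N%:R)).
Proof.
have w0 := outcome_weight_ge0 (n := n) hP.
pose bad o (w : outcome p d n) :=
  noise_level < \sum_i (outcome_tensor R w i - P i) * net_tensor o i.
apply: (@le_trans _ _
  (\sum_(o | @net R p d r rm o) \sum_(w | bad o w) outcome_weight P w)).
  rewrite (exchange_big_dep xpredT) //= big_mkcond /=; apply: ler_sum => w _.
  case: ifP => [|_]; last by apply: sumr_ge0.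
  case/existsP => o ho.
  by rewrite (bigD1 o) //= lerDl sumr_ge0.
have n1 : 0 < n%:R :> R by rewrite ltr0n.
have chern o : @net R p d r rm o -> \sum_(w | bad o w) outcome_weight P w <=
    expR (- ((entropy_rate d + 1) * rm%:R * N%:R)).
  case/andP=> _ h4; apply: le_trans (chernoff_pairing d0 n0 hP _ _) _.
  - exact: sqrtr_ge0.
  - by rewrite -(sum_flat_index d p0 (fun m => train (net_point R o) m ^+ 2)).
  rewrite ler_expR noise_level_sqr lerN2 le_eqVlt; apply/orP; left; apply/eqP.
  by field; rewrite gt_eqF.
apply: le_trans (ler_sum _ chern) _.
have K0 : (0 < net_radius d rm)%N.
  by rewrite /net_radius !muln_gt0 d0 rm0 expn_gt0 muln_gt0 rm0.
set c := expR _.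
have -> : \sum_(o | @net R p d r rm o) c = c * \sum_(o | @net R p d r rm o) 1.
  by rewrite mulr_sumr; apply: eq_bigr => o _; rewrite mulr1.
have card : \sum_(o | @net R p d r rm o) (1 : R) <=
    expR (entropy_rate d * rm%:R * N%:R).
  apply: le_trans (net_entropy_le d N rm0).
  apply: le_trans (grid_ball_card R (core_index p d r) (N * net_radius d rm) K0).
  rewrite big_mkcond [leRHS]big_mkcond; apply: ler_sum => o _.
  by rewrite /net; case: ifP => [/andP[-> _]//|_]; case: ifP.
apply: le_trans (ler_wpM2l (expR_ge0 _) card) _.
by rewrite /c -expRD ler_expR; lra.
Qed.

End UniformConcentration.

Theorem proposition5p2 (R : realType) (d : nat) (hd : (2 <= d)%N)
    (c0 : R) (hc0 : 0 < c0 < 1) :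
  exists C c : R, [/\ 0 < C, 0 < c &
    forall (p n : nat) (r : nat -> nat) (P : tensor R p d)
      (disp : measure_display) (T : measurableType disp)
      (Pr : probability T R) (X : midx p d.-1 -> 'I_n -> T -> 'I_p),
    (0 < p)%N -> (0 < n)%N ->
    r 0%N = 1%N -> r d = 1%N ->
    (forall k, (1 <= k < d)%N -> (0 < r k)%N) ->
    (forall k, (1 <= k <= d)%N ->
       (r k <= r k.-1 * p)%N /\ (r k.-1 <= p * r k)%N) ->
    transition_tensor P -> ergodic P -> state_aggregatable r P ->
    generative_model Pr P X ->
    (Pr [set w : T |
           forall (U Ut : left_family R p r) (V : right_family R p r)
             (P1 Ph : tensor R p d),
           one_step_TTOI (empirical R X w) U V P1 ->
           is_fiber_proj P1 Ph ->
           init_condition c0 P U Ut ->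
           (fnorm2_dist Ph P <=
            C * (\max_(1 <= i < d) r i)%:R *
            ((\sum_(1 <= i < d.+1) p * r i * r i.-1)%N%:R / n%:R))%R]
     >= (1 - C * expR (- (c * p%:R)))%:E)%E].
Proof.
pose D : R := 2 + 16 * (1 - c0 ^+ 2)^-1 ^+ d * 2 ^+ d.
have D0 : 0 <= D.
  have /andP[? ?] := hc0.
  by rewrite /D addr_ge0 // !mulr_ge0 ?exprn_ge0 // invr_ge0; nra.
have E0 := entropy_rate_ge0 R d.
(* 4 comes from the simplex projection, [D] from the algorithm, and the last
   factor from the noise level; the summand 1 serves the failure probability. *)
pose C : R := 1 + 4 * D * (128 * (entropy_rate R d + 1)).
have C1 : 1 <= C.
  by rewrite /C lerDl !mulr_ge0 // addr_ge0.
exists C, 1; split; [lra|lra|].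
move=> p n r P disp T Pr X p0 n0 r0 rd rpos _ hP _ agg gen.
have d0 : (0 < d)%N by lia.
pose rm := (\max_(1 <= i < d) r i)%N.
have r_le_mid k : (1 <= k < d)%N -> (r k <= rm)%N.
  by move=> hk; rewrite /rm (@leq_bigmax_seq _ _ _ r) // mem_index_iota.
have rm0 : (0 < rm)%N by apply: leq_trans (rpos 1%N hd) (r_le_mid 1%N hd).
have r_le k : (k <= d)%N -> (r k)%:R <= rm%:R :> R.
  move=> kd; rewrite ler_nat; have [->|k0] := posnP k; first by rewrite r0.
  by have [->|kd'] := eqVneq k d; [rewrite rd|apply: r_le_mid; lia].
have eN := card_core_index p d r; set N := #|_| in eN.
have pN : (p <= N)%N.
  rewrite eN big_ltn // r0 muln1; apply: leq_trans (leq_addr _ _).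
  by rewrite leq_pmulr // rpos.
pose E (w : outcome p d n) : bool := `[<
  forall (U Ut : left_family R p r) (V : right_family R p r) (P1 Ph : tensor R p d),
  one_step_TTOI (outcome_tensor R w) U V P1 -> is_fiber_proj P1 Ph ->
  init_condition c0 P U Ut ->
  fnorm2_dist Ph P <= C * rm%:R * (N%:R / n%:R) >].
rewrite [X in Pr X](_ : _ = [set w | E (observed X w)]); last first.
  apply/seteqP; split=> w /=.
    by move=> h; apply/asboolP => *; rewrite eN; apply: h;
       rewrite ?empirical_observed; eauto.
  by move/asboolP => h U Ut V P1 Ph; rewrite empirical_observed -eN; apply: h.
rewrite (probability_observed gen) lee_fin.
have good w : ~~ large_noise r rm P w -> E w.
  move=> /existsPn good_w; apply/asboolP => U Ut V P1 Ph ttoi proj init.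
  apply: le_trans (fiber_proj_error d0 hP proj) _.
  have noise (A : cores R) :
      (forall k, (1 <= k <= d)%N -> \sum_(x < p) \sum_(s < r k.-1) \sum_(t < r k)
         A k x s t ^+ 2 <= rm%:R) ->
      \sum_(m < p ^ d) lpart p r A d m 0 ^+ 2 <= 1 ->
      \sum_(m < p ^ d) (flat (outcome_tensor R w) m - flat P m) *
         lpart p r A d m 0 <= noise_level R p d n r rm.
    move=> normA trainA.
    have N0 : (0 < N)%N by apply: leq_trans pN.
    have [u netu le_u] := train_rounding p0 r0 rd rm0 N0
      (fun m => flat (outcome_tensor R w) m - flat P m) normA trainA.
    apply: le_trans le_u _; rewrite (sum_flat_index d p0 (fun m =>
      (flat (outcome_tensor R w) m - flat P m) * train (net_point R u) m)).
    under eq_bigr do rewrite !flat_flat_index //.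
    by have := good_w u; rewrite netu /= -leNgt.
  have := one_step_error p0 hd r0 rd rpos hc0 ttoi init
    (fun k hk => aggregatable_rank p0 hd agg hk) r_le (sqrtr_ge0 _) noise.
  rewrite -/D noise_level_sqr -/N => h.
  apply: (@le_trans _ _ (4 * (D * (128 * (entropy_rate R d + 1) * rm%:R *
     (N%:R / n%:R))))); first by rewrite ler_wpM2l.
  rewrite -subr_ge0 (_ : _ - _ = rm%:R * (N%:R / n%:R)); last by rewrite /C; ring.
  by rewrite !mulr_ge0 ?invr_ge0.
have w0 := outcome_weight_ge0 (n := n) hP.
have split_weight :
    1 - \sum_(w | large_noise (n := n) r rm P w) outcome_weight P w =
    \sum_(w | ~~ large_noise (n := n) r rm P w) outcome_weight P w.
  have := sum_outcome_weight n hP.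
  rewrite (bigID (fun w => large_noise r rm P w)) /= => <-.
  by rewrite addrAC subrr add0r.
apply: (@le_trans _ _
  (1 - \sum_(w | large_noise (n := n) r rm P w) outcome_weight P w)).
  rewrite lerD2l lerN2; apply: le_trans (large_noise_weight _ p0 d0 n0 rm0 hP) _.
  apply: (@le_trans _ _ (expR (- (1 * p%:R)))).
    rewrite ler_expR lerN2 -/N mul1r -natrM ler_nat.
    by apply: leq_trans pN (leq_pmull _ rm0).
  by rewrite ler_peMl ?expR_ge0.
rewrite split_weight big_mkcond [leRHS]big_mkcond; apply: ler_sum => w _.
by case: ifP => [/good -> //|_]; case: ifP.
Qed.
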